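(* Fix a finite alphabet $\Sigma$. There is a polynomial-time algorithm which, given two regular commutative grammars $G$ and $H$ over $\Sigma$, decides whether $\mathrm{out}(G)\cap\mathrm{out}(H)=\emptyset$.
   Context: A commutative grammar is $G=(\Sigma,S,s_0,\delta)$ where $\Sigma$ is a finite alphabet, $S$ a finite set of states, $s_0\in S$, and $\delta\subseteq S\times\mathbb{N}^\Sigma\times\mathbb{N}^S$ a finite set of transitions $\tau=(s,a,t)$ with $\mathrm{source}(\tau)=s$, $\mathrm{out}(\tau)=a$, $\mathrm{target}(\tau)=t$; every state is the source of some transition, and every transition has $|a|\le1$, $|t|\le 2$ (where $|v|=\sum_x v(x)$). It is regular if $|t|\le1$ for all transitions. For $D\in\mathbb{N}^\delta$ let $\mathrm{source}(D)(s)=\sum_{\mathrm{source}(\tau)=s}D(\tau)$, $\mathrm{out}(D)=\sum_\tau D(\tau)\mathrm{out}(\tau)$, $\mathrm{target}(D)=\sum_\tau D(\tau)\mathrm{target}(\tau)$, $\mathrm{supp}(D)=\{s:\mathrm{source}(D)(s)>0\}$. $D$ is a run if $\mathrm{source}(D)=\mathrm{target}(D)+\{s_0\}$ and $D$ is connected from $s_0$, i.e. every $t\in\mathrm{supp}(D)$ equals $s_0$ or is reachable by transitions $\tau_1,\ldots,\tau_m$ with $D(\tau_i)>0$, $\mathrm{source}(\tau_1)=s_0$, $\mathrm{source}(\tau_{i+1})\in\mathrm{target}(\tau_i)$, $t\in\mathrm{target}(\tau_m)$. $\mathrm{out}(G)=\{\mathrm{out}(D):D\text{ a run}\}$. *)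

(* Defs.v *)
From mathcomp Require Import all_boot.
Set Implicit Arguments.
Unset Strict Implicit.
Unset Printing Implicit Defensive.

(* States are 'I_gn; s0 : 'I_gn; transitions are listed in a sequence  *)
(* (required duplicate-free in wf_grammar, so it represents a set).    *)
Record cgrammar (Sigma : finType) := CGrammar {
  gn : nat;
  gs0 : 'I_gn;
  gdelta : seq ('I_gn * {ffun Sigma -> nat} * {ffun 'I_gn -> nat})
}.

Section Grammar.
Variable Sigma : finType.
Variable G : cgrammar Sigma.

Definition vsize (T : finType) (v : {ffun T -> nat}) : nat := \sum_(x : T) v x.

Definition gidx := 'I_(size (gdelta G)).
Definition gtr (i : gidx) := tnth (in_tuple (gdelta G)) i.
Definition gsrc (i : gidx) : 'I_(gn G) := (gtr i).1.1.
Definition gout (i : gidx) : {ffun Sigma -> nat} := (gtr i).1.2.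
Definition gtgt (i : gidx) : {ffun 'I_(gn G) -> nat} := (gtr i).2.

Definition wf_grammar : Prop :=
  [/\ uniq (gdelta G),
      (forall s : 'I_(gn G), exists i : gidx, gsrc i = s) &
      (forall i : gidx, vsize (gout i) <= 1 /\ vsize (gtgt i) <= 2)].

Definition regular_grammar : Prop :=
  wf_grammar /\ forall i : gidx, vsize (gtgt i) <= 1.

Definition sourceD (D : {ffun gidx -> nat}) (s : 'I_(gn G)) : nat :=
  \sum_(i : gidx | gsrc i == s) D i.
Definition outD (D : {ffun gidx -> nat}) : {ffun Sigma -> nat} :=
  [ffun x => \sum_(i : gidx) D i * gout i x].
Definition targetD (D : {ffun gidx -> nat}) : {ffun 'I_(gn G) -> nat} :=
  [ffun s => \sum_(i : gidx) D i * gtgt i s].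

Definition connected_from_s0 (D : {ffun gidx -> nat}) : Prop :=
  forall t : 'I_(gn G), 0 < sourceD D t ->
    t = gs0 G \/
    exists (i1 : gidx) (p : seq gidx),
      [/\ all (fun i => 0 < D i) (i1 :: p),
          gsrc i1 = gs0 G,
          path (fun i j => 0 < gtgt i (gsrc j)) i1 p &
          0 < gtgt (last i1 p) t].

Definition is_run (D : {ffun gidx -> nat}) : Prop :=
  (forall s, sourceD D s = targetD D s + (s == gs0 G)) /\ connected_from_s0 D.

Definition gout_set (v : {ffun Sigma -> nat}) : Prop :=
  exists D, is_run D /\ outD D = v.

Definition grammar_code : seq nat :=
  [:: gn G; val (gs0 G); size (gdelta G)] ++
  flatten (map (fun tr : 'I_(gn G) * {ffun Sigma -> nat} * {ffun 'I_(gn G) -> nat} =>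
                   val tr.1.1 :: [seq tr.1.2 x | x <- enum Sigma] ++
                   [seq tr.2 s | s <- enum 'I_(gn G)]) (gdelta G)).
End Grammar.

Definition enc_nat (n : nat) : seq bool := rcons (nseq n true) false.
Definition enc_nats (s : seq nat) : seq bool := flatten (map enc_nat s).

Definition enc_pair (Sigma : finType) (G H : cgrammar Sigma) : seq bool :=
  enc_nats (grammar_code G ++ grammar_code H).

(* Deterministic single-tape Turing machines over tape alphabet        *)
(* {blank (None), 0, 1}; two-way infinite tape.                        *)
Inductive move := MoveL | MoveR | Stay.

Record TM := MkTM {
  tm_n : nat;
  tm_start : 'I_tm_n.+1;
  tm_delta : 'I_tm_n.+1 -> option bool -> option ('I_tm_n.+1 * option bool * move);
  tm_acc : 'I_tm_n.+1 -> bool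
}.

Record config (M : TM) := Config {
  c_state : 'I_(tm_n M).+1;
  c_left : seq (option bool);   (* cells left of the head, nearest first *)
  c_head : option bool;
  c_right : seq (option bool)   (* cells right of the head, nearest first *)
}.

Definition tm_step (M : TM) (c : config M) : option (config M) :=
  match tm_delta (c_state c) (c_head c) with
  | None => None
  | Some (q, w, m) =>
    Some match m with
    | Stay => Config q (c_left c) w (c_right c)
    | MoveL => match c_left c with
               | [::] => Config q [::] None (w :: c_right c)
               | x :: l => Config q l x (w :: c_right c)
               end
    | MoveR => match c_right c with
               | [::] => Config q (w :: c_left c) None [::]
               | x :: r => Config q (w :: c_left c) x r
               end
    end
  end.

Fixpoint tm_run (M : TM) (c : config M) (t : nat) : config M :=
  match t with
  | 0 => c
  | t'.+1 => match tm_step c with None => c | Some c' => tm_run c' t' end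
  end.

Definition tm_init (M : TM) (w : seq bool) : config M :=
  match w with
  | [::] => Config (tm_start M) [::] None [::]
  | b :: r => Config (tm_start M) [::] (Some b) (map Some r)
  end.

Definition halted (M : TM) (c : config M) : Prop := tm_step c = None.

Definition decides_within (M : TM) (w : seq bool) (T : nat) (b : bool) : Prop :=
  halted (tm_run (tm_init M w) T) /\ tm_acc (c_state (tm_run (tm_init M w) T)) = b.

(* Main.v *)
Require Import Defs.
From mathcomp Require Import all_boot all_order all_algebra.
From mathcomp Require Import zify.
From Stdlib Require Import FunctionalExtensionality.
Set Implicit Arguments.
Unset Strict Implicit.
Unset Printing Implicit Defensive.

(** By Euler's theorem the runs of a regular grammar are the walks from [s0] to
    a sink (the empty target), taken up to order. Erasing loops splits a walk
    into a skeleton of length at most N^2, which still visits every vertex of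
    the walk, and closed walks of length at most N, where N bounds the number
    of vertices. If two walks, one in each grammar, have the same output, then
    the outputs of their closed walks (counted negatively for the second
    grammar) and the difference of the outputs of the skeletons form a zero-sum
    family of vectors in dimension |Sigma| with entries bounded by N^2. Such a
    family splits into zero-sum subfamilies of polynomial size: in one
    coordinate, order the vectors so that partial sums stay bounded and cut at
    repeated partial sums; then repeat with the next coordinate. Reinserting
    only the closed walks of the subfamily that contains the skeletons gives two
    walks of length less than some B, polynomial in the input size, with equal
    outputs.

    Output vectors with entries below B are coded by integers in base B, so that
    two dynamic programming tables indexed by (length, code, state), filled in
    increasing order, decide whether such walks exist. The algorithm is a loop
    program on counters and bit tables. These are laid out as interleaved tracks
    on the tape, to the left of the input; a counter of value v is a run of v
    marks, so that the cell of a bit table at index v is reached by walking to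
    the end of the run. *)

(** * Tape programs and Turing machines *)

(** A closed walk can be reinserted only at a vertex of the walk that is kept. Since it is not known
    beforehand which closed walks survive, the skeleton must keep every vertex, which is why its
    length is bounded by N^2 and not by N. Splitting along one coordinate turns entries bounded by M
    into block sums bounded by M(2M+1), so the degree of the final bound is exponential in |Sigma|.
    It is a constant because the alphabet is fixed; for the same reason the number B^|Sigma| of
    codes is polynomial, and one machine serves all grammars over Sigma. Length belongs to the table
    index because a transition with zero output leaves the code unchanged and may lead to a smaller
    state; with the length, every transition increases the index. Numbers are unary in the input and
    all loop bounds are polynomial, so counters kept in unary on the tape cost only a polynomial
    factor. *)

Definition upd (A : Type) (f : nat -> A) (i : nat) (v : A) : nat -> A :=
  fun j => if j == i then v else f j.

Local Notation tape := (nat -> option bool).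

(** A test sees only the scanned cell, so [TWhile p c1 c2] runs [c1] before each test, to bring the
    head to the cell in question. *)
Inductive tcmd :=
  | TWr of option bool
  | TMv of move
  | TSeq of tcmd & tcmd
  | TIf of (option bool -> bool) & tcmd & tcmd
  | TWhile of (option bool -> bool) & tcmd & tcmd.

(* Positions on the tape are counted leftwards, so that the head never has to
   move right of position 0 and unbounded growth happens at large positions. *)
Inductive texec : tcmd -> tape -> nat -> nat -> tape -> nat -> Prop :=
  | XWr o T h : texec (TWr o) T h 1 (upd T h o) h
  | XStay T h : texec (TMv Stay) T h 1 T h
  | XLeft T h : texec (TMv MoveL) T h 1 T h.+1
  | XRight T h : texec (TMv MoveR) T h.+1 1 T h
  | XSeq c1 c2 T h t1 T1 h1 t2 T2 h2 :
      texec c1 T h t1 T1 h1 -> texec c2 T1 h1 t2 T2 h2 ->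
      texec (TSeq c1 c2) T h (t1 + t2) T2 h2
  | XIfT (p : option bool -> bool) c1 c2 T h t T' h' :
      p (T h) -> texec c1 T h t T' h' ->
      texec (TIf p c1 c2) T h (t + 2) T' h'
  | XIfF (p : option bool -> bool) c1 c2 T h t T' h' :
      ~~ p (T h) -> texec c2 T h t T' h' ->
      texec (TIf p c1 c2) T h (t + 1) T' h'
  | XWhileF (p : option bool -> bool) c1 c2 T h t1 T1 h1 :
      texec c1 T h t1 T1 h1 -> ~~ p (T1 h1) ->
      texec (TWhile p c1 c2) T h (t1 + 1) T1 h1
  | XWhileT (p : option bool -> bool) c1 c2 T h t1 T1 h1 t2 T2 h2 t3 T3 h3 :
      texec c1 T h t1 T1 h1 -> p (T1 h1) ->
      texec c2 T1 h1 t2 T2 h2 -> texec (TWhile p c1 c2) T2 h2 t3 T3 h3 ->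
      texec (TWhile p c1 c2) T h (t1 + 1 + (t2 + 1) + t3) T3 h3.

Fixpoint tsize (c : tcmd) : nat :=
  match c with
  | TWr _ | TMv _ => 1
  | TSeq c1 c2 => tsize c1 + tsize c2
  | TIf _ c1 c2 => 1 + tsize c1 + 1 + tsize c2
  | TWhile _ c1 c2 => tsize c1 + 1 + tsize c2 + 1
  end.

(* Code for [c] occupies the labels [l, l + tsize c) and exits at [l + tsize c]. *)
Fixpoint tcode (c : tcmd) (l q : nat) (x : option bool) : nat * option bool * move :=
  match c with
  | TWr o => (l.+1, o, Stay)
  | TMv m => (l.+1, x, m)
  | TSeq c1 c2 =>
      if q < l + tsize c1 then tcode c1 l q x else tcode c2 (l + tsize c1) q x
  | TIf p c1 c2 =>
      if q == l then (if p x then l.+1 else l.+1 + tsize c1 + 1, x, Stay)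
      else if q < l.+1 + tsize c1 then tcode c1 l.+1 q x
      else if q == l.+1 + tsize c1 then (l.+1 + tsize c1 + 1 + tsize c2, x, Stay)
      else tcode c2 (l.+1 + tsize c1 + 1) q x
  | TWhile p c1 c2 =>
      if q < l + tsize c1 then tcode c1 l q x
      else if q == l + tsize c1 then
        (if p x then (l + tsize c1).+1 else (l + tsize c1).+1 + tsize c2 + 1, x, Stay)
      else if q < (l + tsize c1).+1 + tsize c2 then tcode c2 (l + tsize c1).+1 q x
      else (l, x, Stay)
  end.

(* On exit, a last step moves to a distinguished accepting label when the
   scanned cell is blank. *)
Definition machine (c : tcmd) : TM :=
  @MkTM (tsize c).+1 ord0
    (fun q x =>
       if q < tsize c then
         let: (q', w, m) := tcode c 0 q x in Some (inord q', w, m)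
       else if (q == tsize c :> nat) && (x == None) then
         Some (inord (tsize c).+1, x, Stay)
       else None)
    (fun q => q == (tsize c).+1 :> nat).

Ltac ifs := repeat (case: ifP => ?; try lia); do ?[congr (_, _, _); lia]; try congruence.

(** * Simulation of tape programs by Turing machines *)

Section Simulation.
Variable c0 : tcmd.
Let M := machine c0.

(** Lists are compared through [nth None] because explicit blanks may or may not be stored at their
    ends. Cells to the right of position 0 are unconstrained: they are never scanned. *)
Definition conf_at (cf : config M) (q : nat) (T : tape) (h : nat) : Prop :=
  [/\ nat_of_ord (c_state cf) = q, c_head cf = T h,
      forall j, nth None (c_left cf) j = T (h + 1 + j) &
      forall j, j < h -> nth None (c_right cf) j = T (h - 1 - j)].

Lemma conf_step (cf : config M) q q' w m T h :
  conf_at cf q T h -> q < tsize c0 -> q' <= tsize c0 ->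
  tcode c0 0 q (T h) = (q', w, m) -> (m = MoveR -> 0 < h) ->
  exists2 cf', tm_step cf = Some cf' &
    conf_at cf' q' (upd T h w)
      (match m with MoveL => h.+1 | MoveR => h.-1 | Stay => h end).
Proof.
case: cf => s l x r [/= Eq Ex El Er] ltq leq' Ec Hh.
rewrite /tm_step /= Eq ltq Ex Ec /=.
have Eq' : nat_of_ord (inord q' : 'I_(tsize c0).+2) = q' by rewrite inordK //; lia.
have Tu j : j != h -> upd T h w j = T j by rewrite /upd => /negbTE ->.
have Th : upd T h w h = w by rewrite /upd eqxx.
case: m Hh {Ec} => Hh.
- case: l El => [|y l] El; (eexists; first by []); split => //=.
  + by rewrite Tu; [rewrite -(addn0 h.+1) -addn1 -El | lia].
  + by move=> j; rewrite Tu; [rewrite -[h.+1 + 1 + j]/(h.+1 + 1 + j);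
      rewrite (_ : h.+1 + 1 + j = h + 1 + j.+1) -?El ?nth_nil; [|lia] | lia].
  + case=> [|j] ltj /=; first by rewrite (_ : h.+1 - 1 - 0 = h) ?Th //; lia.
    rewrite Tu; last lia.
    by rewrite (_ : h.+1 - 1 - j.+1 = h - 1 - j) ?Er //; lia.
  + by rewrite Tu; [have /= -> := El 0; congr T; lia | lia].
  + move=> j; rewrite Tu; last lia.
    by have /= -> := El j.+1; congr T; lia.
  + case=> [|j] ltj /=; first by rewrite (_ : h.+1 - 1 - 0 = h) ?Th //; lia.
    rewrite Tu; last lia.
    by rewrite (_ : h.+1 - 1 - j.+1 = h - 1 - j) ?Er //; lia.
- have {Hh} h0 := Hh erefl.
  case: r Er => [|y r] Er; (eexists; first by []); split => //=.
  + rewrite Tu; last lia.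
    by have := Er 0 h0; rewrite /= => ->; congr T; lia.
  + case=> [|j] /=; first by rewrite (_ : h.-1 + 1 + 0 = h) ?Th //; lia.
    by rewrite Tu; [rewrite El; congr T; lia | lia].
  + move=> j ltj; rewrite Tu; last lia.
    have := Er j.+1; rewrite nth_nil => /(_ _) ->; last lia.
    by rewrite nth_nil (_ : _ - _ = h.-1 - 1 - j) //; lia.
  + rewrite Tu; last lia.
    by have := Er 0 h0; rewrite /= => ->; congr T; lia.
  + case=> [|j] /=; first by rewrite (_ : h.-1 + 1 + 0 = h) ?Th //; lia.
    by rewrite Tu; [rewrite El; congr T; lia | lia].
  + move=> j ltj; rewrite Tu; last lia.
    have /= -> := Er j.+1; last lia.
    by congr T; lia.
- (eexists; first by []); split => //= j.
  + by rewrite Tu ?El //; lia.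
  + by move=> ltj; rewrite Tu ?Er //; lia.
Qed.

(** Quantifying over the remaining time makes composition a rewriting step and later combines with
    any halting bound. *)
Definition reaches (cf : config M) (t : nat) (cf' : config M) :=
  forall t0, tm_run cf (t + t0) = tm_run cf' t0.

Lemma reaches_step cf cf' : tm_step cf = Some cf' -> reaches cf 1 cf'.
Proof. by move=> E t0; rewrite add1n /= E. Qed.

Lemma reaches_trans cf1 cf2 cf3 t1 t2 :
  reaches cf1 t1 cf2 -> reaches cf2 t2 cf3 -> reaches cf1 (t1 + t2) cf3.
Proof. by move=> H1 H2 t0; rewrite -addnA H1 H2. Qed.

(** The last hypothesis says that the code of [c] sits in [c0] at label [l]; this relocatable form
    is what the induction on executions needs. *)
Lemma texec_sim c T h t T' h' : texec c T h t T' h' ->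
  forall l cf, conf_at cf l T h -> l + tsize c <= tsize c0 ->
  (forall q x, l <= q < l + tsize c -> tcode c0 0 q x = tcode c l q x) ->
  exists2 cf', reaches cf t cf' & conf_at cf' (l + tsize c) T' h'.
Proof.
(* Every machine step writes; moves and tests write back the scanned symbol, so their tape is
   unchanged only up to this identity. *)
have upd_id (S : tape) i : upd S i (S i) = S.
  by apply: functional_extensionality => j; rewrite /upd; case: eqP => // ->.
elim=> {c T h t T' h'} /=.
- move=> o T h l cf Hc Hl Hq.
  have [||||cf' E Hcf] := conf_step Hc (q' := l.+1) (w := o) (m := Stay); rewrite ?Hq //; try lia.
  by exists cf'; [apply: reaches_step | rewrite addn1].
- move=> T h l cf Hc Hl Hq.
  have [||||cf' E Hcf] := conf_step Hc (q' := l.+1) (w := T h) (m := Stay); rewrite ?Hq //; try lia.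
  by exists cf'; [apply: reaches_step | rewrite addn1 -[T in conf_at _ _ T](upd_id T h)].
- move=> T h l cf Hc Hl Hq.
  have [||||cf' E Hcf] := conf_step Hc (q' := l.+1) (w := T h) (m := MoveL); rewrite ?Hq //; try lia.
  by exists cf'; [apply: reaches_step | rewrite addn1 -[T in conf_at _ _ T](upd_id T h)].
- move=> T h l cf Hc Hl Hq.
  have [||||cf' E Hcf] := conf_step Hc (q' := l.+1) (w := T h.+1) (m := MoveR); rewrite ?Hq //; try lia.
  by exists cf'; [apply: reaches_step | rewrite addn1 -[T in conf_at _ _ T](upd_id T h.+1)].
- move=> c1 c2 T h t1 T1 h1 t2 T2 h2 _ IH1 _ IH2 l cf Hc Hl Hq.
  have [||cf1 R1 Hc1] := IH1 _ _ Hc; [lia | move=> q x Hx |].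
    by rewrite Hq; [ifs | lia].
  have [||cf2 R2 Hc2] := IH2 _ _ Hc1; [lia | move=> q x Hx |].
    by rewrite Hq; [ifs | lia].
  exists cf2; first exact: reaches_trans R1 R2.
  by rewrite addnA.
- move=> p c1 c2 T h t T' h' Hp _ IH l cf Hc Hl Hq.
  have [||||cf1 E1 Hc1] := conf_step Hc (q' := l.+1) (w := T h) (m := Stay);
    do ?[by [] | lia | by rewrite Hq; [ifs | lia]].
  rewrite upd_id in Hc1.
  have [||cf2 R2 Hc2] := IH _ _ Hc1; [lia | move=> q x Hx |].
    by rewrite Hq; [ifs | lia].
  have [||||cf3 E3 Hc3] := conf_step Hc2 (q' := l + (1 + tsize c1 + 1 + tsize c2)) (w := T' h') (m := Stay).
  + lia.
  + lia.
  + by rewrite Hq; [ifs | lia].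
  + by [].
  exists cf3; last by rewrite upd_id in Hc3.
  rewrite (_ : t + 2 = 1 + t + 1); last lia.
  by apply: reaches_trans (reaches_step E3); apply: reaches_trans R2; apply: reaches_step.
- move=> p c1 c2 T h t T' h' Hp _ IH l cf Hc Hl Hq.
  have [||||cf1 E1 Hc1] := conf_step Hc (q' := l.+1 + tsize c1 + 1) (w := T h) (m := Stay);
    do ?[by [] | lia | by rewrite Hq; [ifs | lia]].
  rewrite upd_id in Hc1.
  have [||cf2 R2 Hc2] := IH _ _ Hc1; [lia | move=> q x Hx |].
    by rewrite Hq; [ifs | lia].
  exists cf2; last by rewrite (_ : l + _ = l.+1 + tsize c1 + 1 + tsize c2) //; lia.
  by rewrite addnC; apply: reaches_trans R2; apply: reaches_step.
- move=> p c1 c2 T h t1 T1 h1 _ IH Hp l cf Hc Hl Hq.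
  have [||cf1 R1 Hc1] := IH _ _ Hc; [lia | move=> q x Hx |].
    by rewrite Hq; [ifs | lia].
  have [||||cf2 E2 Hc2] := conf_step Hc1 (q' := (l + tsize c1).+1 + tsize c2 + 1) (w := T1 h1) (m := Stay).
  + lia.
  + lia.
  + by rewrite Hq; [ifs | lia].
  + by [].
  rewrite upd_id in Hc2.
  exists cf2; last by rewrite (_ : l + _ = (l + tsize c1).+1 + tsize c2 + 1) //; lia.
  by apply: reaches_trans R1 (reaches_step E2).
- move=> p c1 c2 T h t1 T1 h1 t2 T2 h2 t3 T3 h3 _ IH1 Hp _ IH2 _ IH3 l cf Hc Hl Hq.
  have [||cf1 R1 Hc1] := IH1 _ _ Hc; [lia | move=> q x Hx |].
    by rewrite Hq; [ifs | lia].
  have [||||cf2 E2 Hc2] := conf_step Hc1 (q' := (l + tsize c1).+1) (w := T1 h1) (m := Stay).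
  + lia.
  + lia.
  + by rewrite Hq; [ifs | lia].
  + by [].
  rewrite upd_id in Hc2.
  have [||cf3 R3 Hc3] := IH2 _ _ Hc2; [lia | move=> q x Hx |].
    by rewrite Hq; [ifs | lia].
  have [||||cf4 E4 Hc4] := conf_step Hc3 (q' := l) (w := T2 h2) (m := Stay).
  + lia.
  + lia.
  + by rewrite Hq; [ifs | lia].
  + by [].
  rewrite upd_id in Hc4.
  have [||cf5 R5 Hc5] := IH3 _ _ Hc4 => //.
  exists cf5 => //.
  do 2!apply: reaches_trans => //; first exact: reaches_trans R1 (reaches_step E2).
    by apply: reaches_trans R3 (reaches_step E4).
Qed.

Lemma tm_run_halted (cf : config M) t : halted cf -> tm_run cf t = cf.
Proof. by rewrite /halted; case: t => //= t ->. Qed.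

(** The first bit has the largest position. Position 0 is a blank just right of the last bit, where
    scans to the right can stop. *)
Definition input_tape (w : seq bool) : tape :=
  fun x => if 1 <= x <= size w then Some (nth false w (size w - x)) else None.

Lemma tm_init_conf w : conf_at (tm_init M w) 0 (input_tape w) (size w).
Proof.
case: w => [|b w]; split => //=.
- by move=> j; rewrite nth_nil.
- by rewrite /input_tape /= subnn ltnS leqnn.
- by move=> j; rewrite nth_nil /input_tape /= ifF //; lia.
- move=> j ltj; rewrite /input_tape /=.
  case: (ltnP j (size w)) => ltj'.
    rewrite (nth_map false) // ifT; last lia.
    by rewrite (_ : _ - (_ - _) = j.+1) //; lia.
  rewrite ifF; last lia.
  by rewrite nth_default // size_map.
Qed.

(** The strict bound on [t] leaves room for the extra step into the accepting label, taken exactly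
    when the scanned cell is blank. *)
Lemma texec_decides w t T' h' Tm :
  texec c0 (input_tape w) (size w) t T' h' -> t < Tm ->
  decides_within M w Tm (T' h' == None).
Proof.
move=> X ltT.
have [||cf R Hcf] := texec_sim X (l := 0) (tm_init_conf w) => //.
have -> : Tm = t + (1 + (Tm - t.+1)) by lia.
rewrite /decides_within R.
case: (altP (T' h' =P None)) => E.
  pose cf' := @Config M (inord (tsize c0).+1) (c_left cf) (T' h') (c_right cf).
  have S : tm_step cf = Some cf'.
    case: cf R Hcf @cf' => s l x r R [/= Eq Ex El Er].
    by rewrite /tm_step /= Eq Ex E add0n ltnn eqxx.
  have H' : halted cf'.
    rewrite /halted /tm_step /= inordK // ifF; last lia.
    by rewrite ifF //; lia.
  rewrite add1n /= S tm_run_halted //; split => //.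
  by rewrite /= inordK // eqxx.
have H' : halted cf.
  case: cf R Hcf => s l x r R [/= Eq Ex El Er].
  by rewrite /halted /tm_step /= Eq Ex add0n ltnn eqxx (negbTE E).
rewrite tm_run_halted //; split => //.
by case: Hcf => /= -> *; lia.
Qed.

End Simulation.

(** * Loop programs and their cost *)

Record store := Store { reg : nat -> nat; bits : nat -> nat -> bool }.

Definition setr (s : store) (r v : nat) : store := Store (upd (reg s) r v) (bits s).
Definition setm (s : store) (a j : nat) : store :=
  Store (reg s) (upd (bits s) a (upd (bits s a) j true)).

Inductive loc := Reg of nat | Mem of nat.

(** A register is seen as the table of its unary representation, so comparing two registers and
    looking up a bit table are the same test. *)
Definition look (s : store) (l : loc) (j : nat) : bool :=
  match l with Reg r => j < reg s r | Mem a => bits s a j end.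

Inductive cmd :=
  | Skip
  | Inc of nat
  | Dec of nat
  | SetBit of nat & nat
  | Seq of cmd & cmd
  | If of loc & nat & cmd & cmd
  | While of loc & nat & cmd.

(* [K] bounds the number of iterations of every execution of a loop. *)
Fixpoint run (K : nat) (c : cmd) (s s' : store) : Prop :=
  match c with
  | Skip => s' = s
  | Inc r => s' = setr s r (reg s r).+1
  | Dec r => s' = setr s r (reg s r).-1
  | SetBit a r => s' = setm s a (reg s r)
  | Seq c1 c2 => exists2 s1, run K c1 s s1 & run K c2 s1 s'
  | If l r c1 c2 => if look s l (reg s r) then run K c1 s s' else run K c2 s s'
  | While l r c1 =>
      exists m (f : nat -> store),
        [/\ m <= K, f 0 = s, f m = s', ~~ look s' l (reg s' r) &
            forall j, j < m -> look (f j) l (reg (f j) r) /\ run K c1 (f j) (f j.+1)]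
  end.

(** This bounds the elementary operations and tests executed, and with them the growth of every
    register, since one operation raises a register by at most one. *)
Fixpoint nops (K : nat) (c : cmd) : nat :=
  match c with
  | Skip | Inc _ | Dec _ | SetBit _ _ => 1
  | Seq c1 c2 => nops K c1 + nops K c2
  | If _ _ c1 c2 => 1 + nops K c1 + nops K c2
  | While _ _ c1 => 1 + K * (1 + nops K c1)
  end.

Fixpoint cmd_size (c : cmd) : nat :=
  match c with
  | Seq c1 c2 | If _ _ c1 c2 => (cmd_size c1 + cmd_size c2).+1
  | While _ _ c1 => (cmd_size c1).+2
  | _ => 1
  end.

(** Each level of loop nesting contributes one factor [K], so the bound is polynomial in [K] for a
    fixed program; [cmd_size] serves as a crude coefficient and degree. *)
Lemma nops_poly K c : nops K c <= cmd_size c * K.+1 ^ cmd_size c.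
Proof.
have le_exp a b : a <= b -> K.+1 ^ a <= K.+1 ^ b by move=> H; rewrite leq_pexp2l.
have H1 a : 0 < K.+1 ^ a by rewrite expn_gt0.
elim: c => [|r|r|a r|c1 IH1 c2 IH2|l r c1 IH1 c2 IH2|l r c1 IH1] /=; rewrite ?mul1n ?expn_gt0 //.
- have := le_exp (cmd_size c1) (cmd_size c1 + cmd_size c2).+1.
  have := le_exp (cmd_size c2) (cmd_size c1 + cmd_size c2).+1.
  move: (_ ^ _.+1) => X /(_ ltac:(lia)) E2 /(_ ltac:(lia)) E1.
  have := leq_mul (leqnn (cmd_size c1)) E1.
  have := leq_mul (leqnn (cmd_size c2)) E2; nia.
- have := le_exp (cmd_size c1) (cmd_size c1 + cmd_size c2).+1.
  have := le_exp (cmd_size c2) (cmd_size c1 + cmd_size c2).+1.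
  have := H1 (cmd_size c1 + cmd_size c2).+1.
  move: (_ ^ _.+1) => X X0 /(_ ltac:(lia)) E2 /(_ ltac:(lia)) E1.
  have := leq_mul (leqnn (cmd_size c1)) E1.
  have := leq_mul (leqnn (cmd_size c2)) E2; nia.
- rewrite 2!expnS.
  have := H1 (cmd_size c1); move: (_ ^ _) IH1 => X IH1 X0.
  have : K * (1 + nops K c1) <= K * (1 + cmd_size c1 * X) by rewrite leq_mul2l; lia.
  nia.
Qed.

(** * Compilation of loop programs to interleaved tracks *)

Section Tracks.
Variables nr nm : nat.

Let k := (nr + nm).+1.

Definition track (l : loc) : nat :=
  match l with Reg r => r.+1 | Mem a => nr.+1 + a end.

Definition wf_loc (l : loc) : bool :=
  match l with Reg r => r < nr | Mem a => a < nm end.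

Fixpoint wf_cmd (c : cmd) : bool :=
  match c with
  | Skip => true
  | Inc r | Dec r => r < nr
  | SetBit a r => (a < nm) && (r < nr)
  | Seq c1 c2 => wf_cmd c1 && wf_cmd c2
  | If l r c1 c2 => [&& wf_loc l, r < nr, wf_cmd c1 & wf_cmd c2]
  | While l r c1 => [&& wf_loc l, r < nr & wf_cmd c1]
  end.

Fixpoint moves (m : move) (n : nat) : tcmd :=
  if n is n'.+1 then TSeq (TMv m) (moves m n') else TMv Stay.

Definition is_some (x : option bool) : bool := x != None.
Definition is_none (x : option bool) : bool := x == None.

Definition walk (i : nat) : tcmd :=
  TSeq (moves MoveL i) (TWhile is_some (TMv Stay) (moves MoveL k)).
Definition retn (i : nat) : tcmd :=
  TSeq (moves MoveR i) (TWhile is_none (TMv Stay) (moves MoveR k)).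
(* Walking to the end of track [r] finds the block whose index is the value of register [r];
   [goto l r] then moves to the cell of [l] in that block. *)
Definition goto (l : loc) (r : nat) : tcmd :=
  TSeq (walk r.+1) (TSeq (moves MoveL (track l - r.+1)) (moves MoveR (r.+1 - track l))).
(** Incrementing [r] is the case where [l] is [Reg r]: the first blank cell after the run of [r]
    gets marked. *)
Definition mark (l : loc) (r : nat) : tcmd :=
  TSeq (goto l r) (TSeq (TWr (Some true)) (retn (track l))).

Fixpoint compile (c : cmd) : tcmd :=
  match c with
  | Skip => TMv Stay
  | Inc r => mark (Reg r) r
  | Dec r =>
      TSeq (walk r.+1) (TSeq (moves MoveR r.+1) (TSeq
        (TIf is_some (TMv Stay)
           (TSeq (moves MoveR k) (TSeq (moves MoveL r.+1)
              (TSeq (TWr None) (moves MoveR r.+1)))))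
        (retn 0)))
  | SetBit a r => mark (Mem a) r
  | Seq c1 c2 => TSeq (compile c1) (compile c2)
  | If l r c1 c2 =>
      TSeq (goto l r) (TIf is_some (TSeq (retn (track l)) (compile c1))
                                   (TSeq (retn (track l)) (compile c2)))
  | While l r c1 =>
      TSeq (TWhile is_some (goto l r) (TSeq (retn (track l)) (compile c1)))
           (retn (track l))
  end.

Variable home : nat.

Definition cell (j i : nat) : nat := home + j * k + i.

(* Track 0 carries the marker of block 0, used to find the way back. *)
Definition trk (s : store) (i j : nat) : bool :=
  if i == 0 then j == 0
  else if i <= nr then j < reg s i.-1 else bits s (i - nr.+1) j.

Definition bit (b : bool) : option bool := if b then Some true else None.

Definition rep (s : store) (T : tape) : Prop :=
  forall j i, i < k -> T (cell j i) = bit (trk s i j).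

Lemma trk_loc s l j : wf_loc l -> trk s (track l) j = look s l j.
Proof.
case: l => [r|a] /= H; rewrite /trk /=; first by rewrite H.
by rewrite ifF; [congr (bits s _ j); lia | lia].
Qed.

Lemma track_lt l : wf_loc l -> track l < k.
Proof. by case: l => [r|a] /=; rewrite /k; lia. Qed.

Lemma cell_inj j i j' i' : i < k -> i' < k -> cell j i = cell j' i' -> j = j' /\ i = i'.
Proof.
move=> ik ik' /eqP; rewrite /cell -!addnA eqn_add2l => /eqP E.
have := congr1 (fun n => n %/ k) E; rewrite /= !divnMDl // !divn_small // !addn0 => Ej.
by split=> //; move: E; rewrite Ej; lia.
Qed.

Lemma movesL T n h : texec (moves MoveL n) T h n.+1 T (h + n).
Proof.
elim: n h => [|n IH] h /=; first by rewrite addn0; constructor.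
by rewrite addnS -addSn -[n.+2]add1n; apply: XSeq (IH _); constructor.
Qed.

Lemma movesR T n h : texec (moves MoveR n) T (h + n) n.+1 T h.
Proof.
elim: n h => [|n IH] h /=; first by rewrite addn0; constructor.
by rewrite addnS -[n.+2]add1n; apply: XSeq (IH _); constructor.
Qed.

Lemma walk_exec T i v :
  (forall j, j < v -> is_some (T (cell j i))) -> T (cell v i) = None ->
  texec (walk i) T home (i.+1 + (v * (k + 4) + 2)) T (cell v i).
Proof.
move=> Hs Hn; apply: XSeq (movesL _ _ _) _.
have W j : j <= v -> texec (TWhile is_some (TMv Stay) (moves MoveL k)) T (cell (v - j) i)
              (j * (k + 4) + 2) T (cell v i).
  elim: j => [|j IH] lej.
    rewrite subn0; apply: (@XWhileF _ _ _ _ _ 1); first by constructor.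
    by rewrite /is_some Hn.
  rewrite (_ : _ + 2 = 1 + 1 + (k.+1 + 1) + (j * (k + 4) + 2)); last lia.
  apply: XWhileT; [by constructor | by apply: Hs; lia | exact: movesL |].
  by rewrite (_ : _ + k = cell (v - j) i); [apply: IH; lia | rewrite /cell; nia].
by rewrite (_ : home + i = cell (v - v) i); [exact: W | rewrite /cell subnn; lia].
Qed.

Lemma retn_exec T i v : (forall j, T (cell j 0) = bit (j == 0)) ->
  texec (retn i) T (cell v i) (i.+1 + (v * (k + 4) + 2)) T home.
Proof.
move=> H0; apply: XSeq (movesR _ _ _) _.
elim: v => [|v IH].
  rewrite mul0n addn0 add0n; apply: (@XWhileF _ _ _ _ _ 1); first by constructor.
  by have := H0 0; rewrite /cell mul0n !addn0 => ->.
rewrite (_ : _ + 2 = 1 + 1 + (k.+1 + 1) + (v * (k + 4) + 2)); last lia.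
apply: XWhileT IH; [by constructor | by have := H0 v.+1; rewrite /cell addn0 => -> |].
by rewrite mulSn addnCA addnC; exact: movesR.
Qed.

Lemma goto_exec s T l r : rep s T -> wf_loc l -> r < nr ->
  exists2 t, texec (goto l r) T home t T (cell (reg s r) (track l)) &
    t <= (3 * k + 10) * (reg s r).+1.
Proof.
move=> HT wl lr; have lk := track_lt wl; have rk : r.+1 < k by rewrite /k; lia.
have tr j : T (cell j r.+1) = bit (j < reg s r) by rewrite HT // /trk /= lr.
eexists.
  apply: XSeq; first by apply: (@walk_exec _ _ (reg s r)) => [j H|]; rewrite tr ?H ?ltnn.
  apply: XSeq; first exact: movesL.
  rewrite (_ : _ + _ = cell (reg s r) (track l) + (r.+1 - track l)); first exact: movesR.
  by rewrite /cell; lia.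
nia.
Qed.

(** The cells before [home] hold the part of the input not yet consumed while the loader already
    writes on the tracks. *)
Definition frame (T T' : tape) : Prop := forall x, x < home -> T' x = T x.

Lemma frame_upd (T : tape) j i v : frame T (upd T (cell j i) v).
Proof. by move=> x ltx; rewrite /upd ifF //; rewrite /cell; lia. Qed.

Lemma frame_trans T1 T2 T3 : frame T1 T2 -> frame T2 T3 -> frame T1 T3.
Proof. by move=> H1 H2 x ltx; rewrite H2 ?H1. Qed.

Lemma upd_cell (T : tape) j i j' i' v : i < k -> i' < k ->
  upd T (cell j i) v (cell j' i') = if (j' == j) && (i' == i) then v else T (cell j' i').
Proof.
move=> ik ik'; rewrite /upd; case: eqP => [/(cell_inj ik' ik) [-> ->]|ne].
  by rewrite !eqxx.
by case: andP => // -[/eqP ej /eqP ei]; case: ne; rewrite ej ei.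
Qed.

Lemma rep_marker s T j : rep s T -> T (cell j 0) = bit (j == 0).
Proof. by move=> ->. Qed.

Lemma mark_exec s s' T l r : rep s T -> wf_loc l -> r < nr ->
  (forall i j, i < k -> trk s' i j = ((j == reg s r) && (i == track l)) || trk s i j) ->
  exists t T', [/\ texec (mark l r) T home t T' home, rep s' T', frame T T' &
    t <= (8 * k + 40) * (reg s r).+1].
Proof.
move=> HT wl lr Hs; have lk := track_lt wl.
have [t X let_] := goto_exec HT wl lr.
have HT' : rep s' (upd T (cell (reg s r) (track l)) (Some true)).
  move=> j i ik; rewrite upd_cell // Hs //.
  by case: ifP => //= _; apply: HT.
do 2!eexists; split.
- apply: XSeq X _; apply: XSeq; first exact: XWr.
  by apply: retn_exec => j; apply: rep_marker HT'.
- exact: HT'.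
- exact: frame_upd.
- nia.
Qed.

Lemma dec_exec s T r : rep s T -> r < nr ->
  exists t T', [/\ texec (compile (Dec r)) T home t T' home,
    rep (setr s r (reg s r).-1) T', frame T T' & t <= (8 * k + 40) * (reg s r).+1].
Proof.
move=> HT lr; have rk : r.+1 < k by rewrite /k; lia.
have tr j : T (cell j r.+1) = bit (j < reg s r) by rewrite HT // /trk /= lr.
have W : texec (walk r.+1) T home (r.+2 + (reg s r * (k + 4) + 2)) T (cell (reg s r) r.+1).
  by apply: walk_exec => [j H|]; rewrite tr ?H ?ltnn.
(* At value 0 the walk ends in block 0, where the marker on track 0 tells that nothing is to be
   erased. Otherwise the last mark of the run is one block back. *)
case Ev: (reg s r) W => [|v] W.
  do 2!eexists; split.
  - apply: XSeq W _; apply: XSeq; first exact: movesR.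
    apply: XSeq; last first.
      by apply: (@retn_exec T 0 0) => j; apply: rep_marker HT.
    rewrite /cell addn0; apply: XIfT; last by constructor.
    by have := rep_marker 0 HT; rewrite /cell /= addn0 => ->.
  - move=> j i ik; rewrite HT // /trk /upd /=.
    by case: ifP => // i0; case: ifP => // _; rewrite /upd; case: (i.-1 =P r) => [->|//]; rewrite Ev.
  - by [].
  - nia.
pose T' := upd T (cell v r.+1) None.
have HT' : rep (setr s r v) T'.
  move=> j i ik; rewrite /T' upd_cell // /trk /= /upd.
  case: (i =P 0) => [->|i0]; first by rewrite andbF HT.
  rewrite HT // /trk (negbTE (introN eqP i0)).
  case: (leqP i nr) => lei; last by rewrite (_ : (i == r.+1) = false) ?andbF //; lia.
  case: (i =P r.+1) => [->|ne] /=.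
    rewrite eqxx andbT Ev ltnS; case: eqP => [->|nv]; first by rewrite ltnn.
    by congr bit; lia.
  by rewrite andbF ifF //; lia.
do 2!eexists; split.
- apply: XSeq W _; apply: XSeq; first exact: movesR.
  apply: XSeq.
    apply: XIfF; first by have := rep_marker v.+1 HT; rewrite /cell /= addn0 => ->.
    rewrite mulSn [k + _]addnC addnA; apply: XSeq; first exact: movesR.
    apply: XSeq; first exact: movesL.
    apply: XSeq; first by constructor.
    exact: movesR.
  rewrite -[X in texec _ _ X]addn0; apply: retn_exec => j; exact: rep_marker HT'.
- exact: HT'.
- exact: frame_upd.
- nia.
Qed.

Let A := 20 * k + 100.

Lemma test_cost t i v n : t <= (3 * k + 10) * v.+1 -> i < k -> v <= n ->
  t + i.+1 + (v * (k + 4) + 2) + 3 <= A * n.+1.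
Proof.
move=> let_ ik levn; apply: (@leq_trans (A * v.+1)); last by rewrite leq_mul2l ltnS levn orbT.
by rewrite /A; nia.
Qed.

(** An operation walks to the end of a run and back, so its cost is linear in the largest register,
    and registers never exceed their initial bound [V] plus the number of operations. *)
Lemma compile_exec K c s s' T V : run K c s s' -> wf_cmd c -> rep s T ->
  (forall r, reg s r <= V) ->
  exists t T', [/\ texec (compile c) T home t T' home, rep s' T', frame T T',
    t <= nops K c * (A * (V + nops K c).+1) & forall r, reg s' r <= V + nops K c].
Proof.
elim: c s s' T V => [|r|r|a r|c1 IH1 c2 IH2|l r c1 IH1 c2 IH2|l r c1 IH1] s s' T V /=.
- move=> -> _ HT HV; exists 1, T; split => //; first by constructor.
  by move=> r; rewrite (leq_trans (HV r)) ?leq_addr.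
- move=> -> lr HT HV.
  have [|t [T' [X HT' F let_]]] := @mark_exec s (setr s r (reg s r).+1) T (Reg r) r HT lr lr.
    move=> i j ik; rewrite /trk /= /upd; case: eqP => [->|i0]; first by rewrite andbF.
    case: (leqP i nr) => lei; last by rewrite (_ : (i == r.+1) = false) ?andbF //; lia.
    have -> : (i.-1 == r) = (i == r.+1) by lia.
    by case: eqP => [->|]; rewrite ?andbT ?andbF //= ltnS leq_eqVlt.
  exists t, T'; split => //; first by have := HV r; rewrite /A; nia.
  by move=> q; rewrite /= /upd; case: eqP => _; have := HV q; have := HV r; lia.
- move=> -> lr HT HV.
  have [t [T' [X HT' F let_]]] := dec_exec HT lr.
  exists t, T'; split => //; first by have := HV r; rewrite /A; nia.
  by move=> q; rewrite /= /upd; case: eqP => _; have := HV q; have := HV r; lia.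
- move=> -> /andP[la lr] HT HV.
  have [|t [T' [X HT' F let_]]] := @mark_exec s (setm s a (reg s r)) T (Mem a) r HT la lr.
    move=> i j ik; rewrite /trk /= /upd; case: eqP => [->|i0]; first by rewrite andbF.
    case: (leqP i nr) => lei; first by rewrite (_ : (i == _) = false) ?andbF //; lia.
    have -> : (i - nr.+1 == a) = (i == nr.+1 + a) by lia.
    case: (i =P _) => [->|]; rewrite ?andbT ?andbF //= addKn.
    by case: eqP.
  exists t, T'; split => //; first by have := HV r; rewrite /A; nia.
  by move=> q; have := HV q; rewrite /=; lia.
- case=> s1 R1 R2 /andP[w1 w2] HT HV.
  have [t1 [T1 [X1 HT1 F1 le1 HV1]]] := IH1 _ _ _ _ R1 w1 HT HV.
  have [t2 [T2 [X2 HT2 F2 le2 HV2]]] := IH2 _ _ _ _ R2 w2 HT1 HV1.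
  exists (t1 + t2), T2; split => //.
  + exact: XSeq X1 X2.
  + exact: frame_trans F1 F2.
  + rewrite mulnDl leq_add //; first by apply: leq_trans le1 _; rewrite !leq_mul2l; lia.
    by apply: leq_trans le2 _; rewrite !leq_mul2l; lia.
  + by move=> q; rewrite addnA.
- move=> R /and4P[wl lr w1 w2] HT HV.
  have [t X let_] := goto_exec HT wl lr.
  have Hh : T (cell (reg s r) (track l)) = bit (look s l (reg s r)).
    by rewrite HT ?track_lt // trk_loc.
  have Xr i : texec (retn i) T (cell (reg s r) i) (i.+1 + (reg s r * (k + 4) + 2)) T home.
    by apply: retn_exec => j; apply: rep_marker HT.
  have lk := track_lt wl; have HVr := HV r.
  have cost n : t + (track l).+1 + (reg s r * (k + 4) + 2) + 3 <= A * (V + n).+1.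
    by apply: test_cost => //; lia.
  case: ifP R Hh => El R Hh.
    have [t1 [T1 [X1 HT1 F1 le1 HV1]]] := IH1 _ _ _ _ R w1 HT HV.
    do 2!eexists; split; [|exact: HT1|exact: F1| |].
    * apply: XSeq X _; apply: XIfT; first by rewrite Hh.
      exact: XSeq (Xr _) X1.
    * have := cost (1 + nops K c1 + nops K c2).
      have : nops K c1 * (A * (V + nops K c1).+1) <=
             nops K c1 * (A * (V + (1 + nops K c1 + nops K c2)).+1).
        by rewrite !leq_mul2l; lia.
      by rewrite !mulnDl mul1n; lia.
    * by move=> q; apply: leq_trans (HV1 q) _; lia.
  have [t1 [T1 [X1 HT1 F1 le1 HV1]]] := IH2 _ _ _ _ R w2 HT HV.
  do 2!eexists; split; [|exact: HT1|exact: F1| |].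
  * apply: XSeq X _; apply: XIfF; first by rewrite Hh.
    exact: XSeq (Xr _) X1.
  * have := cost (1 + nops K c1 + nops K c2).
    have : nops K c2 * (A * (V + nops K c2).+1) <=
           nops K c2 * (A * (V + (1 + nops K c1 + nops K c2)).+1).
      by rewrite !leq_mul2l; lia.
    by rewrite !mulnDl mul1n; lia.
  * by move=> q; apply: leq_trans (HV1 q) _; lia.
- case=> m [f [lem f0 fm Hend Hstep]] /and3P[wl lr w1] HT HV.
  have lk := track_lt wl.
  pose N := nops K c1.
  pose W := A * (V + (1 + m * (1 + N))).+1.
  (* Induction on the number [n] of rounds still to come. A round pays for one test and [N]
     operations, the exit for one more test, each at a price of at most [W]. *)
  have L n : n <= m -> forall T0, rep (f (m - n)) T0 ->
      (forall q, reg (f (m - n)) q <= V + (m - n) * N) ->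
      exists t T', [/\ texec (TWhile is_some (goto l r) (TSeq (retn (track l)) (compile c1)))
          T0 home t T' (cell (reg s' r) (track l)), rep s' T', frame T0 T',
          t + (track l).+1 + (reg s' r * (k + 4) + 2) <= (1 + n * (1 + N)) * W &
          forall q, reg s' q <= V + m * N].
    elim: n => [|n IHn] len T0 HT0 HV0.
      rewrite subn0 fm in HT0 HV0.
      have [t X let_] := goto_exec HT0 wl lr.
      do 2!eexists; split; [|exact: HT0|by []| |by []].
        apply: XWhileF X _; rewrite HT0 // trk_loc //.
        by rewrite (negbTE Hend).
      have := @test_cost _ _ _ (V + (1 + m * (1 + N))) let_ lk.
      have -> : (1 + 0 * (1 + N)) * W = W by rewrite mul0n addn0 mul1n.
      rewrite -/W => /(_ _) H; apply: leq_trans (H _); first lia.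
      by apply: leq_trans (HV0 r) _; rewrite mulnDr; lia.
    have [El R] := Hstep (m - n.+1) ltac:(lia).
    have [t X let_] := goto_exec HT0 wl lr.
    have [t1 [T1 [X1 HT1 F1 le1 HV1]]] := IH1 _ _ _ _ R w1 HT0 HV0.
    have E : (m - n.+1).+1 = m - n by lia.
    rewrite E in HT1 HV1.
    have [|q|t2 [T2 [X2 HT2 F2 le2 HV2]]] := IHn _ _ HT1; [by lia | |].
      by apply: leq_trans (HV1 q) _; rewrite -/N -E; lia.
    do 2!eexists; split; [|exact: HT2|exact: frame_trans F1 F2| |by []].
      apply: XWhileT X _ _ X2.
        by rewrite HT0 // trk_loc // El.
      apply: XSeq X1; apply: retn_exec => j; exact: rep_marker HT0.
    have le1' : t1 <= N * W.
      apply: leq_trans le1 _; rewrite -/N /W !leq_mul2l.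
      by apply/orP; right; apply/orP; right; rewrite -/N; nia.
    have leW : t + (track l).+1 + (reg (f (m - n.+1)) r * (k + 4) + 2) + 3 <= W.
      apply: test_cost => //; apply: leq_trans (HV0 r) _; rewrite leq_add2l.
      apply: (@leq_trans (m * N)); first by rewrite leq_mul2r; lia.
      by rewrite mulnDr; lia.
    rewrite [n.+1 * _]mulSn !mulnDl !mul1n.
    move: le2; rewrite !mulnDl mul1n; lia.
  have [||q|t [T' [X HT' F let_ HV']]] := L m _ T; rewrite ?subnn ?f0 ?mul0n ?addn0 //.
  have leN : m * (1 + N) <= K * (1 + N) by rewrite leq_mul2r lem orbT.
  do 2!eexists; split; [|exact: HT'|exact: F| |].
  + apply: XSeq X _; apply: retn_exec => j; exact: rep_marker HT'.
  + rewrite addnA; apply: leq_trans let_ _; rewrite /W -/N.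
    by apply: leq_mul; rewrite ?leq_mul2l; lia.
  + by move=> q; apply: leq_trans (HV' q) _; rewrite -/N; nia.
Qed.

End Tracks.

(** * Loading the input into a bit table *)

Section Loader.
Variables nr nm : nat.
Hypothesis nr1 : 1 < nr.
Hypothesis nm0 : 0 < nm.

Let k := (nr + nm).+1.

Definition load_seek : tcmd :=
  TSeq (TMv MoveR) (TSeq (TMv MoveR)
    (TSeq (TWhile is_some (TMv Stay) (TMv MoveR)) (TMv MoveL))).
Definition load_back : tcmd :=
  TSeq (TMv MoveL) (TSeq (TWhile is_some (TMv Stay) (TMv MoveL)) (TMv MoveL)).
Definition load_bit : tcmd :=
  TIf (fun x => x == Some true)
    (TSeq (TWr None) (TSeq load_back (TSeq (mark nr nm (Mem 0) 1) (mark nr nm (Reg 1) 1))))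
    (TSeq (TWr None) (TSeq load_back (mark nr nm (Reg 1) 1))).

(* The input is consumed from its end: memory 0 receives it reversed, and
   register 1 its length. *)
Definition load : tcmd := TSeq (TWhile is_some load_seek load_bit) (TMv MoveL).

(* The machine accepts when the first cell of the track of [res] is blank, that is,
   when that register is 0. *)
Definition full_code (c : cmd) (res : nat) : tcmd :=
  TSeq (TSeq (TMv MoveL) (TSeq (TMv MoveL) (TWr (Some true))))
    (TSeq load (TSeq (compile nr nm c) (moves MoveL res.+1))).

Variable w : seq bool.
Let n := size w.
(** Position [n.+1] stays blank and separates the input from the tracks: scans to the left stop
    there, and the seeking phase ends there once the input is used up. *)
Let home := n.+2.

Definition partly_loaded (t : nat) : store :=
  Store (upd (fun=> 0) 1 t)
    (upd (fun _ _ => false) 0 (fun j => (j < t) && nth false (rev w) j)).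

Definition loaded : store :=
  Store (upd (fun=> 0) 1 (size w)) (upd (fun _ _ => false) 0 (nth false (rev w))).

Lemma loaded_all : partly_loaded n = loaded.
Proof.
congr Store; congr upd; apply: functional_extensionality => j.
by case: ltnP => //= le; rewrite nth_default // size_rev.
Qed.

Definition remaining (t : nat) (T : tape) : Prop :=
  forall x, x < home -> T x = if t < x <= n then Some (nth false w (n - x)) else None.

Lemma scan_right T h0 h : h <= h0 -> (forall x, h < x <= h0 -> is_some (T x)) ->
  ~~ is_some (T h) ->
  texec (TWhile is_some (TMv Stay) (TMv MoveR)) T h0 (4 * (h0 - h) + 2) T h.
Proof.
move: {-1}(h0 - h) (erefl (h0 - h)) => d.
elim: d h0 => [|d IH] h0 Ed leh Hs Hn.
  have -> : h0 = h by lia.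
  by apply: (@XWhileF _ _ _ _ _ 1) => //; constructor.
rewrite (_ : _ + 2 = 1 + 1 + (1 + 1) + (4 * d + 2)); last lia.
case: h0 Ed leh Hs => [|h0] Ed leh Hs; first lia.
apply: XWhileT; [by constructor | by apply: Hs; lia | exact: XRight |].
apply: IH; [lia|lia| |by []]; by move=> x Hx; apply: Hs; lia.
Qed.

Lemma scan_left T h0 h : h0 <= h -> (forall x, h0 <= x < h -> is_some (T x)) ->
  ~~ is_some (T h) ->
  texec (TWhile is_some (TMv Stay) (TMv MoveL)) T h0 (4 * (h - h0) + 2) T h.
Proof.
move: {-1}(h - h0) (erefl (h - h0)) => d.
elim: d h0 => [|d IH] h0 Ed leh Hs Hn.
  have -> : h0 = h by lia.
  by apply: (@XWhileF _ _ _ _ _ 1) => //; constructor.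
rewrite (_ : _ + 2 = 1 + 1 + (1 + 1) + (4 * d + 2)); last lia.
apply: XWhileT; [by constructor | by apply: Hs; lia | exact: XLeft |].
apply: IH; [lia|lia| |by []]; by move=> x Hx; apply: Hs; lia.
Qed.

Lemma seek_exec t T : t <= n -> remaining t T ->
  texec load_seek T home (4 * (n - t) + 5) T t.+1.
Proof.
move=> let_ HT; rewrite (_ : _ + 5 = 1 + (1 + (4 * (n - t) + 2 + 1))); last lia.
apply: XSeq; first exact: XRight.
apply: XSeq; first exact: XRight.
apply: XSeq; last exact: XLeft.
apply: scan_right => // [x Hx|]; rewrite HT /home ?ltnn ?andFb //; try lia.
by rewrite ifT //; lia.
Qed.

Lemma back_exec t T : t < n -> remaining t.+1 T ->
  texec load_back T t.+1 (4 * (n - t.+1) + 4) T home.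
Proof.
move=> lt_ HT; rewrite (_ : _ + 4 = 1 + (4 * (n.+1 - t.+2) + 2 + 1)); last lia.
apply: XSeq; first exact: XLeft.
apply: XSeq; last exact: XLeft.
apply: scan_left => // [x Hx|]; rewrite HT /home ?ltnn ?andbF //; try lia.
by rewrite ifT //; lia.
Qed.

Let rep_ := rep nr nm home.

Lemma rep_ext s s' T : (forall i j, i < k -> trk nr s' i j = trk nr s i j) ->
  rep_ s T -> rep_ s' T.
Proof. by move=> E HT j i ik; rewrite HT // E. Qed.

(** The bit is entered while register 1 still holds [t], because that register addresses the cell;
    the resulting store is the next stage except for its length. *)
Lemma mark_inp_exec t T : rep_ (partly_loaded t) T -> nth false (rev w) t ->
  exists t' T', [/\ texec (mark nr nm (Mem 0) 1) T home t' T' home,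
    rep_ (setr (partly_loaded t.+1) 1 t) T', frame home T T' & t' <= (8 * k + 40) * t.+1].
Proof.
move=> HT Hb; apply: (@mark_exec _ _ _ (partly_loaded t)) => // i j ik.
rewrite /trk /= /upd eqxx; case: eqP => [->|i0]; first by rewrite andbF.
case: (leqP i nr) => lei; first by rewrite (_ : (i == nr.+1 + 0) = false) ?andbF; [case: eqP | lia].
have -> : (i - nr.+1 == 0) = (i == nr.+1 + 0) by lia.
case: (i =P _) => [_|]; rewrite ?andbT ?andbF // ltnS leq_eqVlt.
by case: (j =P t) => [->|//]; rewrite Hb.
Qed.

Lemma mark_ptr_exec t T : rep_ (setr (partly_loaded t.+1) 1 t) T ->
  exists t' T', [/\ texec (mark nr nm (Reg 1) 1) T home t' T' home,
    rep_ (partly_loaded t.+1) T', frame home T T' & t' <= (8 * k + 40) * t.+1].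
Proof.
move=> HT; apply: (@mark_exec _ _ _ (setr (partly_loaded t.+1) 1 t)) => // i j ik.
rewrite /trk /= /upd eqxx; case: eqP => [->|i0]; first by rewrite andbF.
case: (leqP i nr) => lei; last by rewrite (_ : (i == 2) = false) ?andbF //; lia.
have -> : (i.-1 == 1) = (i == 2) by lia.
by case: (i =P 2) => [_|]; rewrite ?andbT ?andbF // ltnS leq_eqVlt.
Qed.

Lemma load_bit_exec t T : t < n -> rep_ (partly_loaded t) T -> remaining t T ->
  exists t' T', [/\ texec load_bit T t.+1 t' T' home, rep_ (partly_loaded t.+1) T',
    remaining t.+1 T' & t' <= (16 * k + 90) * n.+1].
Proof.
move=> ltn HT Hr.
have Tt : T t.+1 = Some (nth false (rev w) t).
  by rewrite Hr /home ?nth_rev //; [rewrite ifT //; lia | lia].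
pose T1 := upd T t.+1 None.
have Hr1 : remaining t.+1 T1.
  move=> x Hx; rewrite /T1 /upd; case: eqP => [->|ne]; first by rewrite ltnn.
  by rewrite Hr //; case: ifP => H; case: ifP => //; lia.
have HT1 : rep_ (partly_loaded t) T1.
  move=> j i ik; rewrite /T1 /upd ifF ?HT //.
  by rewrite /cell /home; lia.
have frame_rem T2 : frame home T1 T2 -> remaining t.+1 T2.
  by move=> F x Hx; rewrite F ?Hr1.
have Xb := back_exec ltn Hr1.
rewrite /load_bit; case Eb: (nth false (rev w) t) Tt => Tt.
  have [t2 [T2 [X2 HT2 F2 le2]]] := mark_inp_exec HT1 Eb.
  have [t3 [T3 [X3 HT3 F3 le3]]] := mark_ptr_exec HT2.
  do 2!eexists; split; [|exact: HT3|apply: frame_rem; exact: frame_trans F2 F3|].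
    apply: XIfT; first by rewrite Tt.
    apply: XSeq; first exact: XWr.
    by apply: XSeq Xb _; apply: XSeq X2 X3.
  nia.
have [|t3 [T3 [X3 HT3 F3 le3]]] := @mark_ptr_exec t T1.
  apply: rep_ext HT1 => i j ik; rewrite /trk /= /upd; case: eqP => // i0.
  case: (leqP i nr) => lei; first by case: (i.-1 =P 1).
  case: (i - nr.+1 =P 0) => // _; rewrite ltnS leq_eqVlt.
  by case: (j =P t) => [->|//]; rewrite Eb !andbF.
do 2!eexists; split; [|exact: HT3|apply: frame_rem; exact: F3|].
  apply: XIfF; first by rewrite Tt.
  apply: XSeq; first exact: XWr.
  by apply: XSeq Xb X3.
nia.
Qed.

Definition load_cost : nat := n.+1 * ((16 * k + 100) * n.+1).

Lemma load_exec T : rep_ (partly_loaded 0) T -> remaining 0 T ->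
  exists t' T', [/\ texec load T home t' T' home, rep_ loaded T' & t' <= load_cost].
Proof.
move=> HT0 Hr0; rewrite -loaded_all.
have L d t T1 : d = n - t -> t <= n -> rep_ (partly_loaded t) T1 -> remaining t T1 ->
    exists t' T', [/\ texec (TWhile is_some load_seek load_bit) T1 home t' T' n.+1,
      rep_ (partly_loaded n) T' & t' + 1 <= d.+1 * ((16 * k + 100) * n.+1)].
  elim: d t T1 => [|d IH] t T1 Ed let_ HT Hr.
    have Et : t = n by lia.
    have X := seek_exec let_ Hr; rewrite {}Et in HT Hr X.
    do 2!eexists; split; [apply: XWhileF X _|exact: HT|].
      by rewrite Hr ?ltnn ?andbF.
    nia.
  have X := seek_exec let_ Hr.
  have [|t2 [T2 [X2 HT2 Hr2 le2]]] := load_bit_exec _ HT Hr; first lia.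
  have [||||t3 [T3 [X3 HT3 le3]]] := IH t.+1 T2 => //; try lia.
  do 2!eexists; split; [apply: XWhileT X _ X2 X3|exact: HT3|].
    by rewrite Hr ?ifT //; rewrite /home; lia.
  rewrite [d.+2 * _]mulSn; move: le3; set Z := d.+1 * _; nia.
have [||||t' [T' [X HT' let_]]] := L n 0 T => //; first by rewrite subn0.
exists (t' + 1), T'; split => //.
by apply: XSeq X _; exact: XLeft.
Qed.

Definition total_cost (N : nat) : nat :=
  load_cost + N * ((20 * k + 100) * (n + N).+1) + k + 10.

Lemma program_decides K c res s' Tm :
  run K c loaded s' -> wf_cmd nr nm c -> res < nr -> total_cost (nops K c) <= Tm ->
  decides_within (machine (full_code c res)) w Tm (reg s' res == 0).
Proof.
move=> R wf lr leT.
pose T1 := upd (input_tape w) n.+2 (Some true).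
have HT1 : rep_ (partly_loaded 0) T1.
  move=> j i ik; rewrite /T1 /upd /cell /home /trk /input_tape.
  case: eqP => E.
    have /eqP : j * k = 0 by lia.
    rewrite muln_eq0 orbF => /eqP Ej; rewrite Ej in E *.
    by have -> : i = 0 by lia.
  rewrite ifF; last by rewrite -/n; lia.
  case: eqP E => [->|i0] E; first by case: eqP E => // ->; rewrite mul0n; lia.
  by case: ifP => _ /=; rewrite /upd; case: eqP.
have Hr1 : remaining 0 T1.
  by move=> x Hx; rewrite /T1 /upd ifF //; rewrite /home in Hx; lia.
have [t2 [T2 [X2 HT2 le2]]] := load_exec HT1 Hr1.
have [|t3 [T3 [X3 HT3 F3 le3 _]]] := compile_exec (home := home) (V := n) R wf HT2.
  by move=> r; rewrite /= /upd; case: eqP.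
have -> : (reg s' res == 0) = (T3 (cell nr nm home 0 res.+1) == None).
  by rewrite HT3 /k ?ltnS ?(leq_trans lr) ?leq_addr // /trk /= lr; case: (reg s' res).
apply: (@texec_decides _ _ (1 + (1 + 1) + (t2 + (t3 + res.+2)))); last first.
  by apply: leq_trans leT; rewrite /total_cost -/k; lia.
rewrite /full_code; apply: XSeq.
  apply: XSeq; first exact: XLeft.
  by apply: XSeq; [exact: XLeft | exact: XWr].
apply: XSeq X2 _; apply: XSeq X3 _.
by rewrite (_ : cell _ _ _ _ _ = home + res.+1); [exact: movesL | rewrite /cell mul0n addn0].
Qed.

End Loader.

(** * Programs over counters and bit tables *)

Arguments run : simpl never.

Lemma store_ext s s' : reg s =1 reg s' -> bits s =2 bits s' -> s = s'.
Proof.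
case: s s' => [r m] [r' m'] /= Er Em; congr Store; first exact: functional_extensionality.
by do 2!(apply: functional_extensionality => ?).
Qed.

Ltac case_upd :=
  repeat match goal with
  | |- context [?r == ?n] => let e := fresh "e" in
      case: (r =P n) => e; [first [by exfalso; lia | rewrite ?e {e}] | idtac]; rewrite ?eqxx //=
  end.

Ltac store_eq :=
  apply: store_ext; [let r := fresh "r" in intro r | let a := fresh "a" in let j := fresh "j" in intros a j];
  rewrite /= /upd /=; case_upd.

Lemma run_eq K c s s1 s' : run K c s s1 -> s1 = s' -> run K c s s'.
Proof. by move=> R <-. Qed.

Lemma run_seq K c1 c2 s s1 s' : run K c1 s s1 -> run K c2 s1 s' -> run K (Seq c1 c2) s s'.
Proof. by move=> *; exists s1. Qed.

Lemma run_skip K s : run K Skip s s. Proof. by []. Qed.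

Lemma run_inc K s r : run K (Inc r) s (setr s r (reg s r).+1). Proof. by []. Qed.

Lemma run_dec K s r : run K (Dec r) s (setr s r (reg s r).-1). Proof. by []. Qed.

Lemma run_set K s a r : run K (SetBit a r) s (setm s a (reg s r)). Proof. by []. Qed.

Lemma run_if K l r c1 c2 s s' :
  run K (if look s l (reg s r) then c1 else c2) s s' -> run K (If l r c1 c2) s s'.
Proof. by rewrite /run /=; case: ifP. Qed.

Local Notation "c1 ;; c2" := (Seq c1 c2) (at level 60, right associativity).

(* Register 0 is never written to, hence always 0. *)
Definition clr (x : nat) : cmd := While (Reg x) 0 (Dec x).

Lemma run_clr K s x : x != 0 -> reg s 0 = 0 -> reg s x <= K -> run K (clr x) s (setr s x 0).
Proof.
move=> x0 s0 leK; exists (reg s x), (fun j => setr s x (reg s x - j)).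
have nx : (0 == x) = false by rewrite eq_sym (negbTE x0).
split => //=; rewrite ?subnn ?subn0 /upd ?nx ?s0 ?eqxx //.
  by store_eq.
move=> j ltj; rewrite subn_gt0; split=> //.
store_eq; lia.
Qed.

(** The counter is cleared on exit, so that the loop can be run again inside an outer loop. *)
Definition for_ (i n : nat) (c : cmd) : cmd := While (Reg n) i (c ;; Inc i) ;; clr i.

(** [F j] is the store after [j] rounds with the counter masked to 0; the true store is
    [setr (F j) i j]. Invariants thus need not mention the counter. *)
Lemma run_for K s i n c (F : nat -> store) :
  i != 0 -> i != n -> reg s n <= K -> F 0 = s ->
  (forall j, j <= reg s n -> [/\ reg (F j) i = 0, reg (F j) 0 = 0 & reg (F j) n = reg s n]) ->
  (forall j, j < reg s n -> run K c (setr (F j) i j) (setr (F j.+1) i j)) ->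
  run K (for_ i n c) s (F (reg s n)).
Proof.
move=> i0 ni leK F0 HF Hc.
have ni' : (n == i) = false by rewrite eq_sym (negbTE ni).
apply: (@run_seq _ _ _ _ (setr (F (reg s n)) i (reg s n))).
  exists (reg s n), (fun j => setr (F j) i j); split => //.
  - by have [+ _ _] := HF 0 isT; rewrite F0 => Ei; store_eq.
  - have [_ _ E] := HF _ (leqnn _).
    by rewrite /= /upd ni' eqxx E ltnn.
  - move=> j ltj; split.
      have [_ _ E] := HF j (ltnW ltj).
      by rewrite /= /upd ni' eqxx E.
    apply: run_seq (Hc j ltj) _; apply: run_eq (run_inc _ _ _) _.
    by rewrite /= /upd eqxx; store_eq.
apply: run_eq; first apply: run_clr => //.
- by have [_ E _] := HF _ (leqnn _); rewrite /= /upd eq_sym (negbTE i0).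
- by rewrite /= /upd eqxx.
have [E _ _] := HF _ (leqnn _).
by store_eq.
Qed.

Definition addto (x y : nat) : cmd := for_ 2 y (Inc x).

Lemma run_addto K s x y : uniq [:: 0; 2; x; y] ->
  reg s 0 = 0 -> reg s 2 = 0 -> reg s y <= K ->
  run K (addto x y) s (setr s x (reg s x + reg s y)).
Proof.
move=> U s0 s2 leK; have [x0 x2 y2 xy] : [/\ x != 0, x != 2, y != 2 & x != y].
  by move: U; rewrite /= !inE; split; lia.
pose F j := setr s x (reg s x + j).
apply: (@run_for _ _ 2 y _ F) => //.
- by rewrite eq_sym.
- by rewrite /F addn0; store_eq.
- move=> j lej; rewrite /= /upd ![_ == x]eq_sym.
  by rewrite (negbTE x0) (negbTE x2) (negbTE xy).
- move=> j ltj; apply: run_eq (run_inc _ _ _) _.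
  rewrite /= /upd (negbTE x2) eqxx.
  by store_eq; lia.
Qed.

Definition addmul (z x y : nat) : cmd := for_ 3 x (addto z y).

Lemma run_addmul K s z x y : uniq [:: 0; 2; 3; x; z] -> uniq [:: 0; 2; 3; y; z] ->
  reg s 0 = 0 -> reg s 2 = 0 -> reg s 3 = 0 -> reg s x <= K -> reg s y <= K ->
  run K (addmul z x y) s (setr s z (reg s z + reg s x * reg s y)).
Proof.
rewrite /= !inE => Ux Uy s0 s2 s3 lex ley.
pose F j := setr s z (reg s z + j * reg s y).
refine (@run_for K s 3 x (addto z y) F _ _ _ _ _ _) => //; try lia.
- by rewrite /F mul0n addn0; store_eq.
- by move=> j lej; rewrite /= /upd ![_ == z]eq_sym !ifF //; lia.
- move=> j ltj; apply: run_eq; first apply: run_addto => //=; rewrite ?inE /upd ?ifF //; try lia.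
  rewrite /= /upd eqxx !ifF; try lia.
  by store_eq; try lia; rewrite mulSn; lia.
Qed.

Definition mulby (x y : nat) : cmd := addmul 4 x y ;; clr x ;; addto x 4 ;; clr 4.

Lemma run_mulby K s x y : uniq [:: 0; 2; 3; 4; x; y] ->
  reg s 0 = 0 -> reg s 2 = 0 -> reg s 3 = 0 -> reg s 4 = 0 ->
  reg s x <= K -> reg s y <= K -> reg s x * reg s y <= K ->
  run K (mulby x y) s (setr s x (reg s x * reg s y)).
Proof.
rewrite /= !inE /mulby => U s0 s2 s3 s4 lex ley lexy.
apply: run_seq.
  by apply: run_addmul => //=; rewrite ?inE; lia.
apply: run_seq.
  by apply: run_clr; rewrite /= /upd ?ifF //; lia.
apply: run_seq.
  by apply: run_addto; rewrite //= ?inE /upd ?ifF ?s4 //; lia.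
apply: run_eq.
  by apply: run_clr; rewrite /= /upd /= ?ifF ?s4 //; lia.
rewrite /= /upd eqxx ifF; last lia.
by store_eq; rewrite ?s4 //; lia.
Qed.

Arguments upd A f i v j /.

(* The input is stored reversed; the position of the suffix [enc_nats l] is its length. *)
Definition reads (code l : seq nat) : Prop := exists l0, code = l0 ++ l.

Lemma reads_cat code l1 l2 : reads code (l1 ++ l2) -> reads code l2.
Proof. by case=> l0 ->; exists (l0 ++ l1); rewrite catA. Qed.

Definition pos (l : seq nat) : nat := size (enc_nats l).

Lemma enc_nats_cat l1 l2 : enc_nats (l1 ++ l2) = enc_nats l1 ++ enc_nats l2.
Proof. by rewrite /enc_nats map_cat flatten_cat. Qed.

Lemma pos_cat l1 l2 : pos (l1 ++ l2) = pos l1 + pos l2.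
Proof. by rewrite /pos enc_nats_cat size_cat. Qed.

Lemma pos_cons v l : pos (v :: l) = v.+1 + pos l.
Proof. by rewrite /pos /enc_nats /= size_cat /enc_nat size_rcons size_nseq. Qed.

Definition stored (code : seq nat) (s : store) : Prop :=
  forall j, bits s 0 j = nth false (rev (enc_nats code)) j.

(** In reversed order the terminator of a number lies at index [pos l], below its ones. Decreasing
    register 1 from [pos (v :: l)] therefore meets the ones first and stops at [pos l], where the
    next number is expected. *)
Lemma stored_bit code s v l j : stored code s -> reads code (v :: l) -> j <= v ->
  bits s 0 (pos l + j) = (0 < j).
Proof.
move=> -> [l0 ->] lejv; rewrite enc_nats_cat rev_cat nth_cat size_rev.
rewrite -/(pos _) pos_cons ifT; last lia.
have -> : enc_nats (v :: l) = enc_nat v ++ enc_nats l by [].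
rewrite rev_cat nth_cat size_rev -/(pos l) ifF; last lia.
rewrite addKn /enc_nat rev_rcons; case: j lejv => //= j ltj.
by rewrite nth_rev size_nseq ?nth_nseq //; case: ifP => //; lia.
Qed.

Definition readnum (x : nat) : cmd :=
  Dec 1 ;; While (Mem 0) 1 (Inc x ;; Dec 1).

Lemma run_readnum K s code x v l : x != 1 -> stored code s -> reads code (v :: l) ->
  reg s 1 = pos (v :: l) -> v <= K ->
  run K (readnum x) s (setr (setr s x (reg s x + v)) 1 (pos l)).
Proof.
move=> x1 Hs Hr E1 lev; apply: run_seq; first exact: run_dec.
exists v, (fun j => setr (setr s x (reg s x + j)) 1 (pos l + (v - j))); split=> //.
- by rewrite E1 pos_cons; store_eq; lia.
- by rewrite subnn addn0.
- have := stored_bit Hs Hr (leq0n v).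
  by rewrite addn0 /= => ->.
- move=> j ltj; split.
    by rewrite /= (stored_bit Hs Hr) ?leq_subr ?subn_gt0.
  apply: run_seq; first exact: run_inc.
  apply: run_eq (run_dec _ _ _) _.
  by rewrite /= (negbTE x1) eqxx; store_eq; lia.
Qed.

(* [rP] is the reading position, [rQ] that of the first transition, [rN] the input
   length plus 2, [rBASE] = [rNODE] - [rS], and [rF] records that a target was seen. *)
Local Notation rP := 1.
Local Notation rN := 5.
Local Notation rB := 6.
Local Notation rC := 7.
Local Notation rGN := 8.
Local Notation rG1 := 9.
Local Notation rS0 := 10.
Local Notation rSZ := 11.
Local Notation rQ := 12.
Local Notation rTIME := 13.
Local Notation rCC := 14.
Local Notation rS := 15.
Local Notation rNODE := 16.
Local Notation rBASE := 17.
Local Notation rI := 18.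
Local Notation rSRC := 19.
Local Notation rADR := 20.
Local Notation rW := 21.
Local Notation rY := 22.
Local Notation rF := 23.
Local Notation rBAD := 24.
Local Notation rJ := 25.

Definition ready (s : store) : Prop :=
  [/\ reg s 0 = 0, reg s 2 = 0, reg s 3 = 0 & reg s 4 = 0].

(* One 0/1 coordinate of the output vector per unrolling; [rW] runs through the weights. *)
Fixpoint read_outs (d : nat) : cmd :=
  if d is d'.+1 then
    readnum rY ;; If (Reg rY) 0 (addto rADR rW) Skip ;; clr rY ;;
    mulby rW rB ;; read_outs d'
  else Skip.

(** The number with base [B] digits [0 < y], lowest digit first, scaled by [w]. *)
Fixpoint weigh (B w : nat) (outs : seq nat) : nat :=
  if outs is y :: o then (0 < y) * w + weigh B (w * B) o else 0.

Definition regs3 s p a w := setr (setr (setr s rP p) rADR a) rW w.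

Lemma run_read_outs K code outs l s :
  stored code s -> ready s -> reg s rY = 0 -> 0 < reg s rB ->
  reads code (outs ++ l) -> reg s rP = pos (outs ++ l) ->
  all (fun v => v <= K) outs -> reg s rB <= K -> reg s rW * reg s rB ^ size outs <= K ->
  run K (read_outs (size outs)) s
    (regs3 s (pos l) (reg s rADR + weigh (reg s rB) (reg s rW) outs)
       (reg s rW * reg s rB ^ size outs)).
Proof.
move=> Hs [r0 r2 r3 r4] rY0 B0.
elim: outs s Hs r0 r2 r3 r4 rY0 B0 => [|y outs IH] s Hs r0 r2 r3 r4 rY0 B0 Hr EP.
  by move=> _ _ _; rewrite /regs3 addn0 muln1 -EP; store_eq.
move=> /= /andP[ley leo] leB leW.
have leW1 : reg s rW <= K.
  by apply: leq_trans leW; rewrite leq_pmulr ?expn_gt0 ?B0.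
have leW2 : reg s rW * reg s rB <= K.
  by apply: leq_trans leW; rewrite expnS mulnA leq_pmulr ?expn_gt0 ?B0.
apply: run_seq; first exact: run_readnum Hs Hr EP ley.
set s1 := setr _ _ _.
have R2 : run K (If (Reg rY) 0 (addto rADR rW) Skip) s1
   (setr s1 rADR (reg s rADR + (0 < y) * reg s rW)).
  apply: run_if; rewrite /= r0 rY0 add0n; case: (0 < y).
    by apply: run_eq; [apply: run_addto | rewrite mul1n].
  by apply: run_eq; [apply: run_skip | rewrite mul0n addn0; store_eq].
apply: run_seq R2 _.
apply: run_seq; first by apply: run_clr; rewrite //= rY0.
apply: run_seq; first exact: run_mulby.
apply: run_eq.
  apply: IH => //=.
  - exact: (@reads_cat code [:: y]).
  - by rewrite -mulnA -expnS.
by rewrite /regs3 /= -mulnA -expnS addnA; store_eq.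
Qed.

(* The sink has index [gn], which is where the counter ends up if no target is present. *)
Definition read_tgts : cmd :=
  for_ rJ rGN
    (readnum rY ;;
     If (Reg rY) 0 (Inc rF) (If (Reg rF) 0 Skip (Inc rADR)) ;;
     clr rY) ;;
  clr rF.

Definition target_of (tgts : seq nat) : nat := find (fun y => 0 < y) tgts.

Lemma run_read_tgts K code tgts l s :
  stored code s -> ready s -> reg s rY = 0 -> reg s rJ = 0 -> reg s rF = 0 ->
  reads code (tgts ++ l) -> reg s rP = pos (tgts ++ l) ->
  reg s rGN = size tgts ->
  all (fun v => v <= K) tgts -> size tgts <= K ->
  run K read_tgts s
    (setr (setr s rP (pos l)) rADR (reg s rADR + target_of tgts)).
Proof.
move=> Hs [r0 r2 r3 r4] rY0 rJ0 rF0 Hr EP Egn leK leszK.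
(* The address advances until the first positive entry, where [minn] freezes it; [rF] counts the
   positive entries met so far. *)
pose F j := setr (setr (setr s rP (pos (drop j tgts ++ l))) rADR
      (reg s rADR + minn j (target_of tgts))) rF (count (fun y => 0 < y) (take j tgts)).
apply: run_seq.
  apply: (@run_for _ _ _ _ _ F) => //.
  - by rewrite Egn.
  - by rewrite /F drop0 take0 /= min0n addn0; store_eq.
  - move=> j; rewrite Egn => ltj.
    have Edrop := drop_nth 0 ltj.
    have Hrd : reads code (drop j tgts ++ l).
      by apply: (@reads_cat _ (take j tgts)); rewrite catA cat_take_drop.
    have leyK : nth 0 tgts j <= K by apply: (allP leK); exact: mem_nth.
    apply: run_seq.
      apply: (@run_readnum _ _ code _ (nth 0 tgts j) (drop j.+1 tgts ++ l)) => //.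
      + by rewrite -cat_cons -Edrop.
      + by rewrite -cat_cons -Edrop.
    set s1 := setr _ rP _.
    have Ec : count (fun y => 0 < y) (take j.+1 tgts) =
              count (fun y => 0 < y) (take j tgts) + (0 < nth 0 tgts j).
      by rewrite (take_nth 0 ltj) -cats1 count_cat /= addn0.
    have R2 : run K (If (Reg rY) 0 (Inc rF) (If (Reg rF) 0 Skip (Inc rADR))) s1
        (setr (setr s1 rADR (reg s rADR + minn j.+1 (target_of tgts)))
            rF (count (fun y => 0 < y) (take j.+1 tgts))).
      apply: run_if; rewrite /= r0 rY0 add0n Ec.
      have find_lt : 0 < nth 0 tgts j -> target_of tgts <= j.
        by move=> H; rewrite leqNgt; apply/negP => /(before_find 0); rewrite H.
      case: (posnP (nth 0 tgts j)) => [Ey|/find_lt lej].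
        rewrite addn0; apply: run_if; rewrite /= r0 -has_count.
        case: ifP => Hh.
          have lej : target_of tgts <= j.
            rewrite -{1}(cat_take_drop j tgts) /target_of find_cat Hh.
            by rewrite (leq_trans (find_size _ _)) // size_take; case: ifP => //; lia.
          by apply: run_eq; [exact: run_skip | rewrite /s1; store_eq; lia].
        have gtj : j < target_of tgts.
          rewrite -(cat_take_drop j tgts) /target_of find_cat Hh size_takel; last lia.
          rewrite Edrop /= Ey /=; lia.
        apply: run_eq; [exact: run_inc | by rewrite /s1; store_eq; lia].
      rewrite addn1; apply: run_eq; first exact: run_inc.
      by rewrite /s1 /=; store_eq; lia.
    apply: run_seq R2 _; apply: run_eq; first by apply: run_clr; rewrite //= rY0.
    by store_eq.
apply: run_eq; first apply: run_clr => //=.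
  by rewrite (leq_trans (count_size _ _)) // size_take; case: ifP => //; lia.
rewrite Egn /F drop_size (minn_idPr _) ?find_size //.
by store_eq.
Qed.

(** * Reading transitions and filling one table *)

Local Notation trans := (nat * (seq nat * seq nat))%type.

Definition trans_code (tr : trans) : seq nat := tr.1 :: tr.2.1 ++ tr.2.2.

Definition seta (s : store) (a : nat) (A : nat -> bool) : store :=
  Store (reg s) (upd (bits s) a A).

Definition temps : seq nat := [:: 0; 2; 3; 4; rSRC; rADR; rW; rY; rF; rJ].

Definition quiet (s : store) : Prop := forall r, r \in temps -> reg s r = 0.

Lemma quietE s : quiet s ->
  (reg s 0 = 0) * (reg s 2 = 0) * (reg s 3 = 0) * (reg s 4 = 0) * (reg s rSRC = 0) *
  (reg s rADR = 0) * (reg s rW = 0) * (reg s rY = 0) * (reg s rF = 0) * (reg s rJ = 0).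
Proof. by move=> q; rewrite !q. Qed.

(** After [read_outs] the weight in [rW] has become [g1 * B ^ d], which is one unit of length in
    node numbering and is added for that purpose. Equality of [rS] and [rSRC] is tested by excluding
    both strict inequalities. *)
Definition read_trans (R d : nat) : cmd :=
  readnum rSRC ;; addto rADR rBASE ;; addto rW rG1 ;; read_outs d ;;
  addto rADR rW ;; clr rW ;; read_tgts ;;
  If (Reg rS) rSRC Skip (If (Reg rSRC) rS Skip (If (Mem R) rNODE (SetBit R rADR) Skip)) ;;
  clr rADR ;; clr rSRC.

(** Nodes number triples (length, output code, state) as [(code + length * B ^ d) * g1 + state].
    With [base] the current node minus its state, a transition adds its output code and one unit of
    length, and installs the new state. *)
Definition dest (B g1 d base : nat) (tr : trans) : nat :=
  base + weigh B g1 tr.2.1 + g1 * B ^ d + target_of tr.2.2.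

Definition fire (B g1 d base s x : nat) (A : nat -> bool) (tr : trans) : nat -> bool :=
  if (tr.1 == s) && A x then upd A (dest B g1 d base tr) true else A.

Definition fits (K d gn : nat) (tr : trans) : Prop :=
  [/\ all (fun v => v <= K) (trans_code tr), size tr.2.1 = d & size tr.2.2 = gn].

Lemma run_read_trans K R d code tr l s :
  R != 0 -> stored code s -> quiet s -> 0 < reg s rB ->
  reads code (trans_code tr ++ l) -> reg s rP = pos (trans_code tr ++ l) ->
  fits K d (reg s rGN) tr -> reg s rGN <= K -> reg s rB <= K ->
  dest (reg s rB) (reg s rG1) d (reg s rBASE) tr <= K -> reg s rG1 * reg s rB ^ d <= K ->
  run K (read_trans R d) s
    (seta (setr s rP (pos l)) R
       (fire (reg s rB) (reg s rG1) d (reg s rBASE) (reg s rS) (reg s rNODE) (bits s R) tr)).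
Proof.
case: tr => src [outs tgts] R0 Hs q B0 Hr EP [/= /andP[lesrc]].
rewrite all_cat => /andP[leo let_] Ed Egn legn leB; rewrite /dest /= => leD leG; have {}q := quietE q.
have R0' : (0 == R) = false by rewrite eq_sym (negbTE R0).
rewrite /trans_code /= -catA in Hr EP.
have lebase : reg s rBASE <= K by lia.
have leG1 : reg s rG1 <= K by apply: leq_trans leG; rewrite leq_pmulr ?expn_gt0 ?B0.
apply: run_seq; first exact: run_readnum Hs Hr EP lesrc.
apply: run_seq; first by apply: run_addto; rewrite //= q.
apply: run_seq; first by apply: run_addto; rewrite //= q.
rewrite /= !q !add0n.
apply: run_seq.
  rewrite -Ed; apply: (run_read_outs (code := code) (l := tgts ++ l)) => //=; rewrite ?q ?Ed //.
  - by split; rewrite /= q.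
  - exact: (@reads_cat _ [:: src]).
rewrite /regs3 /= Ed.
apply: run_seq; first by apply: run_addto; rewrite //= q.
apply: run_seq; first by apply: run_clr; rewrite //= q.
apply: run_seq.
  apply: (run_read_tgts (code := code) (tgts := tgts) (l := l)); rewrite //= ?q -?Egn //.
  - by split; rewrite /= q.
  - exact: (@reads_cat _ (src :: outs)).
  - by rewrite Egn.
set s1 := setr _ rADR _.
have [e1 e2 e3 e4 e5] : [/\ reg s1 rS = reg s rS, reg s1 rSRC = src, reg s1 rNODE = reg s rNODE,
   reg s1 rADR = dest (reg s rB) (reg s rG1) d (reg s rBASE) (src, (outs, tgts)) &
   bits s1 = bits s] by [].
apply: (@run_seq _ _ _ _ (seta s1 R (fire (reg s rB) (reg s rG1) d (reg s rBASE) (reg s rS) (reg s rNODE) (bits s R) (src, (outs, tgts))))).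
  have same : s1 = seta s1 R (bits s R) by rewrite /seta -e5; store_eq.
  apply: run_if; rewrite /look e1 e2 /fire [_.1]/=; case: (ltngtP src (reg s rS)) => H /=.
  - by rewrite -same; apply: run_skip.
  - by apply: run_if; rewrite /look e1 e2 H -same; apply: run_skip.
  - apply: run_if; rewrite /look e1 e2 H ltnn.
    apply: run_if; rewrite /look e3 e5; case: ifP => _; last by rewrite -same; apply: run_skip.
    apply: run_eq; first exact: run_set.
    by rewrite /setm e4 e5.
apply: run_seq; first by apply: run_clr; rewrite //= ?q ?add0n.
apply: run_eq; first by apply: run_clr; rewrite //= ?q ?add0n.
by store_eq; rewrite q.
Qed.

Definition read_all (R d : nat) : cmd := for_ rI rSZ (read_trans R d).

Definition all_code (ts : seq trans) : seq nat := flatten (map trans_code ts).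

Lemma run_read_all K R d code ts l s :
  R != 0 -> stored code s -> quiet s -> 0 < reg s rB -> reg s rI = 0 ->
  reads code (all_code ts ++ l) -> reg s rP = pos (all_code ts ++ l) ->
  reg s rSZ = size ts -> size ts <= K ->
  (forall tr, tr \in ts -> fits K d (reg s rGN) tr) -> reg s rGN <= K -> reg s rB <= K ->
  (forall tr, tr \in ts -> dest (reg s rB) (reg s rG1) d (reg s rBASE) tr <= K) ->
  reg s rG1 * reg s rB ^ d <= K ->
  run K (read_all R d) s
    (seta (setr s rP (pos l)) R
       (foldl (fire (reg s rB) (reg s rG1) d (reg s rBASE) (reg s rS) (reg s rNODE)) (bits s R) ts)).
Proof.
move=> R0 Hs q B0 rI0 Hr EP Esz lesz Hf legn leB leD leG.
have R0' : (0 == R) = false by rewrite eq_sym (negbTE R0).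
pose F j := seta (setr s rP (pos (all_code (drop j ts) ++ l))) R
  (foldl (fire (reg s rB) (reg s rG1) d (reg s rBASE) (reg s rS) (reg s rNODE)) (bits s R) (take j ts)).
apply: run_eq.
  apply: (@run_for _ _ _ _ _ F) => //.
  - by rewrite Esz.
  - by rewrite /F drop0 take0 /= /seta; store_eq.
  - by move=> j _; rewrite /F /= rI0 q.
  - move=> j; rewrite Esz => ltj.
    have x0 : trans by exact: (0, ([::], [::])).
    have Edrop := drop_nth x0 ltj.
    have Min : nth x0 ts j \in ts by apply: mem_nth.
    have E : all_code (drop j ts) ++ l = trans_code (nth x0 ts j) ++ all_code (drop j.+1 ts) ++ l.
      by rewrite Edrop /all_code /= catA.
    have Hrj : reads code (trans_code (nth x0 ts j) ++ all_code (drop j.+1 ts) ++ l).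
      rewrite -E; apply: (@reads_cat _ (all_code (take j ts))).
      by rewrite catA -flatten_cat -map_cat cat_take_drop.
    apply: run_eq.
      apply: (@run_read_trans _ R _ code (nth x0 ts j) (all_code (drop j.+1 ts) ++ l)) => //=.
      + by move=> i /=; rewrite R0' Hs.
      + move=> r Hr0 /=; have := Hr0; rewrite !inE.
        by case: (r =P rP) => [->//|_]; case: (r =P rI) => [->//|_]; rewrite q.
      + by rewrite E.
      + exact: Hf.
      + exact: leD.
    rewrite /F /= (take_nth x0 ltj) foldl_rcons /= eqxx.
    by store_eq.
by rewrite /F Esz drop_size take_size.
Qed.

(** The list of transitions is read again for every node. Table [A] records only nodes at the sink,
    and only their output code [rCC]: the length is forgotten. *)
Definition node_body (R A d : nat) : cmd :=
  clr rP ;; addto rP rQ ;; read_all R d ;;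
  If (Reg rGN) rS Skip (If (Mem R) rNODE (SetBit A rCC) Skip) ;; Inc rNODE.

Definition scan (R A d : nat) : cmd :=
  for_ rTIME rB (for_ rCC rC (for_ rS rG1 (node_body R A d) ;; addto rBASE rG1)).

Section Table.
Variables (B g1 d s0 : nat) (ts : seq trans).

Definition advance (x : nat) : (nat -> bool) -> (nat -> bool) :=
  fun T => foldl (fire B g1 d (x - x %% g1) (x %% g1) x) T ts.

(* A transition leads to a larger node, so one pass in increasing order suffices. *)
Fixpoint tab (x : nat) : nat -> bool :=
  if x is y.+1 then advance y (tab y) else upd (fun=> false) s0 true.

(** [y %/ g1] is the output code plus [C] times the length, so the remainder modulo [C] drops the
    length. *)
Fixpoint acc (C x : nat) : nat -> bool :=
  if x is y.+1 then
    if (y %% g1 == g1.-1) && tab x y then upd (acc C y) ((y %/ g1) %% C) true else acc C y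
  else fun=> false.
End Table.

(** Computed addresses must stay below [K] as well: clearing a register takes as many rounds as its
    value. *)
Record setting (K R A d N : nat) (code l : seq nat) (ts : seq trans) (s : store) : Prop := {
  setR : R != 0; setA : A != 0; setRA : R != A;
  set_stored : stored code s; set_quiet : quiet s; set_I : reg s rI = 0;
  set_B : 0 < reg s rB <= K;
  set_reads : reads code (all_code ts ++ l);
  set_Q : reg s rQ = pos (all_code ts ++ l); set_Qle : reg s rQ <= K; set_l : pos l <= K;
  set_SZ : reg s rSZ = size ts; set_SZle : size ts <= K;
  set_fits : forall tr, tr \in ts -> fits K d (reg s rGN) tr;
  set_G1 : reg s rG1 = (reg s rGN).+1; set_G1le : reg s rG1 <= K;
  set_GB : reg s rG1 * reg s rB ^ d <= K;
  set_C : reg s rC <= K;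
  set_dest : forall base tr, base <= N -> tr \in ts ->
    dest (reg s rB) (reg s rG1) d base tr <= K }.

Definition steady : seq nat := temps ++ [:: rI; rB; rQ; rSZ; rGN; rG1; rC].

Lemma setting_ext K R A d N code l ts s s' :
  setting K R A d N code l ts s -> (forall j, bits s' 0 j = bits s 0 j) ->
  (forall r, r \in steady -> reg s' r = reg s r) ->
  setting K R A d N code l ts s'.
Proof.
case=> h1 h2 h3 h4 h5 h6 h7 h8 h9 h10 h11 h12 h13 h14 h15 h16 h17 h18 h19 Em Er.
have E := (Er rI isT, Er rB isT, Er rQ isT, Er rSZ isT, Er rGN isT, Er rG1 isT, Er rC isT).
split; rewrite ?E //; first by move=> j; rewrite Em.
by move=> r Hr; rewrite Er ?h5 // mem_cat Hr.
Qed.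

Lemma run_node K R A d N code l ts s :
  setting K R A d N code l ts s -> reg s rP <= K -> reg s rBASE <= N ->
  reg s rS <= reg s rGN ->
  let T := foldl (fire (reg s rB) (reg s rG1) d (reg s rBASE) (reg s rS) (reg s rNODE))
             (bits s R) ts in
  run K (node_body R A d) s
    (seta (seta (setr (setr s rP (pos l)) rNODE (reg s rNODE).+1) R T) A
      (if (reg s rS == reg s rGN) && T (reg s rNODE) then upd (bits s A) (reg s rCC) true
       else bits s A)).
Proof.
move=> St leP leN leS T.
have [R0 A0 RA Hs q rI0 /andP[B0 leB] Hr EQ leQ lel Esz lesz Hf EG leG leGB leC leD] := St.
have q0 : reg s 0 = 0 by rewrite q.
have q2 : reg s 2 = 0 by rewrite q.
have AR : (A == R) = false by rewrite eq_sym (negbTE RA).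
apply: run_seq; first exact: run_clr.
apply: run_seq; first by apply: run_addto.
rewrite /= add0n.
have St1 : setting K R A d N code l ts (setr (setr s rP 0) rP (reg s rQ)).
  by apply: (setting_ext St) => //= r; rewrite !inE; do !case: eqP => [->|_] //.
apply: run_seq.
  apply: (@run_read_all _ R _ code ts l) => //; try by case: St1.
  - by rewrite /= (leq_trans _ leG) ?EG.
  - by move=> tr Htr; apply: leD.
rewrite /= -/T.
set s1 := seta _ R _.
apply: (@run_seq _ _ _ _ (seta s1 A (if (reg s rS == reg s rGN) && T (reg s rNODE)
     then upd (bits s A) (reg s rCC) true else bits s A))).
  have same : s1 = seta s1 A (bits s A).
    by rewrite /s1 /seta; store_eq.
  have e : bits s1 R = T by rewrite /= eqxx.
  apply: run_if; rewrite [look _ _ _](_ : _ = (reg s rS < reg s rGN)) //.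
  case: ltngtP leS => // H _.
  apply: run_if; rewrite [look _ _ _](_ : _ = T (reg s rNODE)); last by rewrite -e.
  rewrite andTb; case: ifP => _; last exact: run_eq (run_skip _ _) same.
  apply: run_eq; first exact: run_set.
  by rewrite /setm /seta /= AR.
apply: run_eq; first exact: run_inc.
rewrite /s1 /=; store_eq.
Qed.

Lemma run_scan K R A d code l ts s s0 :
  setting K R A d (reg s rB * reg s rC * reg s rG1) code l ts s ->
  reg s rP = reg s rQ -> reg s rTIME = 0 -> reg s rCC = 0 -> reg s rS = 0 ->
  reg s rNODE = 0 -> reg s rBASE = 0 -> 
  bits s R = upd (fun=> false) s0 true -> bits s A = (fun=> false) ->
  0 < reg s rC ->
  let B := reg s rB in let C := reg s rC in let g1 := reg s rG1 in
  let N := B * C * g1 in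
  run K (scan R A d) s
    (seta (seta (setr (setr (setr s rP (pos l)) rNODE N) rBASE N)
       R (tab B g1 d s0 ts N)) A (acc B g1 d s0 ts C N)).
Proof.
move=> St EP T0 CC0 S0 N0 BA0 ER EA C0 B C g1 N.
have [R0 A0 RA Hs q rI0 /andP[B0 leB] Hr EQ leQ lel Esz lesz Hf EG leG leGB leC leD] := St.
have q0 : reg s 0 = 0 by rewrite q.
have q2 : reg s 2 = 0 by rewrite q.
have AR : (A == R) = false by rewrite eq_sym (negbTE RA).
have OR : (0 == R) = false by rewrite eq_sym (negbTE R0).
have OA : (0 == A) = false by rewrite eq_sym (negbTE A0).
have g0 : 0 < g1 by rewrite /g1 EG.
(* Before the first node the reading position has its initial value; each node leaves it at
   [pos l]. *)
pose st x base cc time :=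
  seta (seta (setr (setr (setr (setr (setr s rP (if x == 0 then reg s rP else pos l)) rNODE x)
     rBASE base) rCC cc) rTIME time) R (tab B g1 d s0 ts x)) A (acc B g1 d s0 ts C x).
have Hst x base cc time j : setting K R A d N code l ts (setr (st x base cc time) rS j).
  apply: (setting_ext St) => [i|r] /=; first by rewrite OR OA.
  by rewrite !inE; do !case: eqP => [->|_] //.
have inner time cc : time < B -> cc < C ->
    run K (for_ rS rG1 (node_body R A d)) (st ((time * C + cc) * g1) ((time * C + cc) * g1) cc time)
      (st ((time * C + cc) * g1 + g1) ((time * C + cc) * g1) cc time).
  move=> ltt ltc; set x0 := (_ + _) * _.
  apply: (@run_for _ _ _ _ _ (fun j => st (x0 + j) x0 cc time)) => //; first by rewrite addn0.
    rewrite /= -/g1 => j ltj.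
    have lex : x0 + g1 <= N.
      rewrite /x0 /N -mulSnr leq_mul2r; apply/orP; right.
      rewrite -addnS (leq_trans (_ : _ <= time.+1 * C)) ?leq_mul2r ?ltt ?orbT //.
      by rewrite mulSn addnC leq_add2r.
    apply: run_eq.
      apply: run_node (Hst _ _ _ _ _) _ _ _ => /=.
      + by case: ifP; rewrite ?EP.
      + by rewrite (leq_trans _ lex) ?leq_addr.
      + by rewrite /g1 EG in ltj.
    have Em : (x0 + j) %% g1 = j by rewrite /x0 modnMDl modn_small.
    have Ed : (x0 + j) %/ g1 %% C = cc.
      by rewrite /x0 divnMDl // divn_small // addn0 modnMDl modn_small.
    have ER' : foldl (fire B g1 d x0 j (x0 + j)) (tab B g1 d s0 ts (x0 + j)) ts =
       tab B g1 d s0 ts (x0 + j.+1).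
      by rewrite addnS /= /advance Em addnK.
    rewrite /= eqxx [R == A](negbTE RA) ER' /= -/B -/C -/g1.
    have EGN : reg s rGN = g1.-1 by rewrite /g1 EG.
    have accS : acc B g1 d s0 ts C (x0 + j).+1 =
        if (j == g1.-1) && tab B g1 d s0 ts (x0 + j).+1 (x0 + j)
        then upd (acc B g1 d s0 ts C (x0 + j)) cc true else acc B g1 d s0 ts C (x0 + j).
      by rewrite /= Em Ed.
    rewrite EGN addnS eqxx -accS.
    by rewrite /st; store_eq.
have middle time : time < B ->
    run K (for_ rCC rC (for_ rS rG1 (node_body R A d) ;; addto rBASE rG1))
      (st (time * C * g1) (time * C * g1) 0 time)
      (st (time.+1 * C * g1) (time.+1 * C * g1) 0 time).
  move=> ltt.
  apply: run_eq.
    apply: (@run_for _ _ _ _ _ (fun j => st ((time * C + j) * g1) ((time * C + j) * g1) 0 time)) => //.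
      by rewrite addn0.
    rewrite /= -/C => j ltj.
    have -> : setr (st ((time * C + j) * g1) ((time * C + j) * g1) 0 time) rCC j =
        st ((time * C + j) * g1) ((time * C + j) * g1) j time by rewrite /st; store_eq.
    apply: run_eq.
      apply: run_seq; first exact: inner.
      by apply: run_addto.
    rewrite /= -/g1; rewrite (_ : (time * C + j) * g1 + g1 = (time * C + j.+1) * g1); last by rewrite addnS mulSnr.
    by rewrite /st; store_eq.
  by rewrite /= -/C -mulSnr.
apply: run_eq.
  apply: (@run_for _ _ _ _ _ (fun j => st (j * C * g1) (j * C * g1) 0 0)) => //.
    rewrite /st !mul0n [tab _ _ _ _ _ 0](esym ER) [acc _ _ _ _ _ _ 0](esym EA).
    by store_eq.
  move=> j ltj.
  have -> : setr (st (j * C * g1) (j * C * g1) 0 0) rTIME j = st (j * C * g1) (j * C * g1) 0 j.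
    by rewrite /st; store_eq.
  by apply: run_eq (middle j ltj) _; rewrite /st; store_eq.
rewrite /= -/B -/N /st.
have -> : (N == 0) = false by rewrite /N !muln_eq0; lia.
by store_eq.
Qed.

(** The initial node has length and code 0, so its index is the initial state itself. The final
    clearing lets the same commands run on the second grammar, at whose code the reading position is
    left. *)
Definition table (R A d : nat) : cmd :=
  readnum rGN ;; readnum rS0 ;; readnum rSZ ;; addto rG1 rGN ;; Inc rG1 ;;
  SetBit R rS0 ;; addto rQ rP ;; scan R A d ;;
  clr rGN ;; clr rS0 ;; clr rSZ ;; clr rG1 ;; clr rQ ;; clr rNODE ;; clr rBASE.

Definition zeros : seq nat :=
  temps ++ [:: rI; rGN; rS0; rSZ; rG1; rQ; rTIME; rCC; rS; rNODE; rBASE].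

Lemma weigh_le B w outs : 0 < B -> weigh B w outs <= size outs * (w * B ^ size outs).
Proof.
move=> B0; elim: outs w => [|y o IH] w //=.
rewrite mulSn leq_add //.
  apply: (@leq_trans (w * 1)); last by rewrite leq_mul2l expn_gt0 B0 orbT.
  by rewrite muln1; case: (0 < y); rewrite ?mul1n.
by rewrite expnS [w * (B * _)]mulnA; exact: IH.
Qed.

(** This is where unary encoding matters: numbers in the input can serve as loop bounds. *)
Lemma pos_ge v l : v \in l -> v < pos l.
Proof.
elim: l => // y l IH; rewrite inE pos_cons => /orP[/eqP ->|/IH]; lia.
Qed.

Lemma zerosE s : (forall r, r \in zeros -> reg s r = 0) ->
  (reg s 0 = 0) * (reg s 2 = 0) * (reg s rI = 0) * (reg s rGN = 0) * (reg s rS0 = 0) *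
  (reg s rSZ = 0) * (reg s rG1 = 0) * (reg s rQ = 0) * (reg s rTIME = 0) * (reg s rCC = 0) *
  (reg s rS = 0) * (reg s rNODE = 0) * (reg s rBASE = 0).
Proof. by move=> z; rewrite !z. Qed.

Lemma run_table K R A d code gn s0 ts l s :
  R != 0 -> A != 0 -> R != A -> stored code s ->
  (forall r, r \in zeros -> reg s r = 0) ->
  bits s R = (fun=> false) -> bits s A = (fun=> false) ->
  reads code ([:: gn; s0; size ts] ++ all_code ts ++ l) ->
  reg s rP = pos ([:: gn; s0; size ts] ++ all_code ts ++ l) -> reg s rP <= K ->
  (forall tr, tr \in ts -> size tr.2.1 = d /\ size tr.2.2 = gn) ->
  let B := reg s rB in let C := reg s rC in let g1 := gn.+1 in let N := B * C * g1 in
  0 < B -> C = B ^ d -> d.+3 * N <= K ->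
  run K (table R A d) s
    (seta (seta (setr s rP (pos l)) R (tab B g1 d s0 ts N)) A (acc B g1 d s0 ts C N)).
Proof.
move=> R0 A0 RA Hs z ER EA Hr EP lePK Hts B C g1 N B0 EC leN.
have zE := zerosE z.
have OR : (0 == R) = false by rewrite eq_sym (negbTE R0).
have OA : (0 == A) = false by rewrite eq_sym (negbTE A0).
have C0 : 0 < C by rewrite EC expn_gt0 B0.
have posle : gn.+1 + (s0.+1 + ((size ts).+1 + pos (all_code ts ++ l))) <= K.
  by move: lePK; rewrite EP /= !pos_cons.
have leNK : N <= K by apply: leq_trans leN; rewrite leq_pmull.
have leBK : B <= K.
  by apply: leq_trans leNK; rewrite /N -mulnA leq_pmulr // muln_gt0 C0.
have leGCN : g1 * C <= N by rewrite /N -mulnA [C * _]mulnC leq_pmull.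
have leCK : C <= K by apply: leq_trans leNK; apply: leq_trans leGCN; rewrite leq_pmull.
apply: run_seq; first by apply: run_readnum Hs Hr EP _; lia.
apply: run_seq.
  apply: (@run_readnum _ _ code _ s0 (size ts :: all_code ts ++ l)) => //=; last lia.
  exact: (@reads_cat _ [:: gn]).
apply: run_seq.
  apply: (@run_readnum _ _ code _ (size ts) (all_code ts ++ l)) => //=; last lia.
  exact: (@reads_cat _ [:: gn; s0]).
apply: run_seq; first by apply: run_addto; rewrite //= ?zE //; lia.
apply: run_seq; first exact: run_inc.
apply: run_seq; first exact: run_set.
apply: run_seq; first by apply: run_addto; rewrite //= ?zE //; lia.
rewrite /= !zE !add0n.
set s1 := setr _ rQ _.
have St : setting K R A d (B * C * g1) code l ts s1.
  split => //=; rewrite ?zE // -/B -/g1 -/C.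
  - by move=> j; rewrite /= OR Hs.
  - move=> r Hr0 /=; do !case: eqP => [E|_]; try by rewrite E in Hr0.
    by rewrite z // mem_cat Hr0.
  - by rewrite B0.
  - exact: (@reads_cat _ [:: gn; s0; size ts]).
  - lia.
  - by move: posle; rewrite pos_cat; lia.
  - lia.
  - move=> tr Htr; have [E1 E2] := Hts tr Htr; split => //.
    apply/allP => v Hv; apply: ltnW; apply: (@leq_trans (pos (all_code ts ++ l))); last lia.
    apply: pos_ge; rewrite mem_cat; apply/orP; left.
    by apply/flattenP; exists (trans_code tr) => //; apply: map_f.
  - lia.
  - by rewrite -EC; lia.
  (* Base, length unit and target state are each at most [N], and the output code weighs at most
     [d * N]; hence the factor [d.+3]. *)
  - move=> base tr leb Htr; have [E1 E2] := Hts tr Htr.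
    have := weigh_le g1 tr.2.1 B0; rewrite E1 -EC /dest -EC => lew.
    have : target_of tr.2.2 <= gn by rewrite -E2 find_size.
    have : d * (g1 * C) <= d * N by rewrite leq_mul2l leGCN orbT.
    have : gn <= N.
      apply: leq_trans leGCN; rewrite /g1; apply: (@leq_trans (gn.+1 * 1)); first lia.
      by rewrite leq_mul2l C0 orbT.
    by move: leN; rewrite -/g1 /= [d.+3 * N](_ : _ = 3 * N + d * N); [lia | rewrite -mulnDl].
have Es0 : reg s1 rB * reg s1 rC * reg s1 rG1 = B * C * g1 by [].
apply: run_seq.
  apply: (@run_scan _ R A d code l ts s1 s0) => //=; rewrite ?zE //.
  - by rewrite eqxx ER.
  - by rewrite eq_sym (negbTE RA).
rewrite -/B -/C -/g1 -/N.
set R' := tab _ _ _ _ _ _; set A' := acc _ _ _ _ _ _ _.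
do 6!(apply: run_seq; first by apply: run_clr; rewrite //= ?zE //; lia).
apply: run_eq; first by apply: run_clr; rewrite //= ?zE //; lia.
by store_eq; rewrite ?zE.
Qed.

(** * The complete program *)

Fixpoint power (e x y : nat) : cmd :=
  if e is e'.+1 then mulby x y ;; power e' x y else Skip.

Lemma run_power K e s x y : uniq [:: 0; 2; 3; 4; x; y] -> ready s -> 0 < reg s y <= K ->
  reg s x * reg s y ^ e <= K ->
  run K (power e x y) s (setr s x (reg s x * reg s y ^ e)).
Proof.
move=> U; have := U; rewrite /= !inE => U'.
elim: e s => [|e IH] s /= [r0 r2 r3 r4] /andP[y0 leyK] leK.
  by rewrite muln1; apply: run_eq (run_skip _ _) _; store_eq.
have lexy : reg s x * reg s y <= K.
  by apply: leq_trans leK; rewrite expnS mulnA leq_pmulr ?expn_gt0 ?y0.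
have lex : reg s x <= K by apply: leq_trans lexy; rewrite leq_pmulr.
apply: run_seq; first exact: run_mulby.
set s1 := setr s x _.
have Ex : reg s1 x = reg s x * reg s y by rewrite /= eqxx.
have Er r : r != x -> reg s1 r = reg s r by move=> /= /negbTE ->.
have Ey : reg s1 y = reg s y by apply: Er; lia.
apply: run_eq.
  apply: IH; rewrite ?Ex ?Ey ?y0 //; first by split; rewrite Er //; lia.
  by rewrite -mulnA -expnS.
rewrite Ex Ey -mulnA -expnS.
by store_eq.
Qed.

Definition program (d e : nat) : cmd :=
  addto rN rP ;; Inc rN ;; Inc rN ;; Inc rB ;; power e rB rN ;; Inc rC ;; power d rC rB ;;
  table 1 3 d ;; table 2 4 d ;;
  for_ rCC rC (If (Mem 3) rCC (If (Mem 4) rCC (Inc rBAD) Skip) Skip).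

Definition nr_program := 26.
Definition nm_program := 5.

Lemma wf_read_outs d : wf_cmd nr_program nm_program (read_outs d).
Proof. by elim: d => // d IH; rewrite [wf_cmd _ _ _]/= IH. Qed.

Lemma wf_power e x y : x < nr_program -> y < nr_program ->
  wf_cmd nr_program nm_program (power e x y).
Proof. by move=> lx ly; elim: e => // e IH; rewrite [wf_cmd _ _ _]/= IH lx ly. Qed.

Lemma wf_table R A d : R < nm_program -> A < nm_program ->
  wf_cmd nr_program nm_program (table R A d).
Proof.
by move=> lR lA; rewrite /table /scan /node_body /read_all /read_trans [wf_cmd _ _ _]/= wf_read_outs lR lA.
Qed.

Lemma wf_seq nr nm c1 c2 :
  wf_cmd nr nm c1 -> wf_cmd nr nm c2 -> wf_cmd nr nm (c1 ;; c2).
Proof. by move=> w1 w2; rewrite /= w1. Qed.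

Lemma wf_program d e : wf_cmd nr_program nm_program (program d e).
Proof.
do 4!(apply: wf_seq => //); apply: wf_seq; first exact: wf_power.
apply: wf_seq => //; apply: wf_seq; first exact: wf_power.
by apply: wf_seq; [exact: wf_table | apply: wf_seq; first exact: wf_table].
Qed.

Definition graph_code (gn s0 : nat) (ts : seq trans) : seq nat :=
  [:: gn; s0; size ts] ++ all_code ts.

Lemma run_program K d e gn s0 ts gn' s0' ts' :
  let code := graph_code gn s0 ts ++ graph_code gn' s0' ts' in
  let n := pos code in let B := n.+2 ^ e in let C := B ^ d in
  let N := B * C * gn.+1 in let N' := B * C * gn'.+1 in
  (forall tr, tr \in ts -> size tr.2.1 = d /\ size tr.2.2 = gn) ->
  (forall tr, tr \in ts' -> size tr.2.1 = d /\ size tr.2.2 = gn') ->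
  n.+2 <= K -> d.+3 * N <= K -> d.+3 * N' <= K ->
  exists2 s', run K (program d e) (loaded (enc_nats code)) s' &
    reg s' rBAD == 0 =
    ~~ has (fun c => acc B gn.+1 d s0 ts C N c && acc B gn'.+1 d s0' ts' C N' c) (iota 0 C).
Proof.
move=> code n B C N N' Hts Hts' lenK leN leN'.
have B0 : 0 < B by rewrite expn_gt0.
have C0 : 0 < C by rewrite expn_gt0 B0.
have leNK : N <= K by apply: leq_trans leN; rewrite leq_pmull.
have leBK : B <= K.
  by apply: leq_trans leNK; rewrite /N -mulnA leq_pmulr // muln_gt0 C0.
have leCK : C <= K.
  by apply: leq_trans leNK; rewrite /N -mulnA mulnCA leq_pmulr // muln_gt0 B0.
set s := loaded _.
have Es : reg s rP = n by [].
pose A1 := acc B gn.+1 d s0 ts C N.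
pose A2 := acc B gn'.+1 d s0' ts' C N'.
pose fin := fun j => count (fun c => A1 c && A2 c) (iota 0 j).
eexists.
  apply: run_seq; first by apply: run_addto; rewrite ?Es //; lia.
  apply: run_seq; first exact: run_inc.
  apply: run_seq; first exact: run_inc.
  apply: run_seq; first exact: run_inc.
  rewrite [reg _ rP]Es /= add0n.
  apply: run_seq; first by apply: run_power; rewrite //= mul1n.
  rewrite /= mul1n -/B.
  apply: run_seq; first exact: run_inc.
  apply: run_seq; first by apply: run_power; rewrite //= ?mul1n ?B0.
  rewrite /= mul1n -/B -/C.
  apply: run_seq.
    apply: (@run_table _ 1 3 d code gn s0 ts (graph_code gn' s0' ts')) => //=.
    - by move=> r; rewrite !inE; do !case: eqP => [->|_] //.
    - by exists [::].
    - by apply: leq_trans lenK; rewrite -[X in _ <= X]addn2 leq_addr.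
  apply: run_seq.
    apply: (@run_table _ 2 4 d code gn' s0' ts' [::]) => //=.
    - by move=> r; rewrite !inE; do !case: eqP => [->|_] //.
    - by exists (graph_code gn s0 ts); rewrite cats0.
    - by rewrite cats0.
    - by move: lenK; rewrite /n /code pos_cat; lia.
  rewrite /= -/B -/C -/N -/N' -/A1 -/A2.
  set s2 := seta _ 4 _.
  apply: (@run_for _ _ _ _ _ (fun j => setr s2 rBAD (fin j))) => //.
    by store_eq.
  rewrite [reg _ rC]/= => j ltj.
  have -> : fin j.+1 = fin j + (A1 j && A2 j).
    by rewrite /fin -addn1 iotaD count_cat /= addn0.
  apply: run_if; rewrite [look _ _ _](_ : _ = A1 j) //; case: (A1 j).
    apply: run_if; rewrite [look _ _ _](_ : _ = A2 j) //; case: (A2 j).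
      by apply: run_eq (run_inc _ _ _) _; store_eq; lia.
    by rewrite addn0; exact: run_skip.
  by rewrite addn0; exact: run_skip.
by rewrite /= has_count -eqn0Ngt.
Qed.

(** * What the tables contain *)

Lemma weighM B w outs : weigh B w outs = w * weigh B 1 outs.
Proof.
elim: outs w => [|y o IH] w /=; first by rewrite muln0.
rewrite IH [weigh B (1 * B) o]IH; lia.
Qed.

Lemma weighE B outs : weigh B 1 outs = \sum_(j < size outs) (0 < nth 0 outs j) * B ^ j.
Proof.
elim: outs => [|y o IH] /=; first by rewrite big_ord0.
rewrite big_ord_recl /= muln1 weighM IH mul1n big_distrr /=; congr (_ + _).
by apply: eq_bigr => j _; rewrite expnS mulnCA.
Qed.

Definition digit (w : seq trans) (j : nat) : nat := \sum_(tr <- w) (0 < nth 0 tr.2.1 j).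

Lemma digit_le w j : digit w j <= size w.
Proof. by rewrite /digit -sum1_size leq_sum // => tr _; case: (0 < _). Qed.

Lemma digits_lt B (f : nat -> nat) n : (forall j, f j < B) -> \sum_(j < n) f j * B ^ j < B ^ n.
Proof.
move=> Hf; elim: n => [|n IH]; first by rewrite big_ord0.
rewrite big_ord_recr /= expnS.
have : (f n).+1 * B ^ n <= B * B ^ n by rewrite leq_mul2r Hf orbT.
rewrite mulSn; apply: leq_trans; rewrite -addSn.
by rewrite leq_add2r.
Qed.

Lemma digits_inj B n (f g : nat -> nat) : (forall j, f j < B) -> (forall j, g j < B) ->
  \sum_(j < n) f j * B ^ j = \sum_(j < n) g j * B ^ j -> forall j, j < n -> f j = g j.
Proof.
move=> Hf Hg; elim: n => // n IH; rewrite !big_ord_recr /= => E.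
have Bn : 0 < B ^ n by rewrite expn_gt0 (leq_ltn_trans _ (Hf 0)).
have lf := digits_lt n Hf; have lg := digits_lt n Hg.
have En : f n = g n.
  have := congr1 (fun m => m %/ B ^ n) E.
  by rewrite /= ![\sum_(_ < _) _ + _]addnC !divnMDl // !divn_small // !addn0.
move=> j; rewrite ltnS leq_eqVlt => /orP[/eqP -> //|]; apply: IH.
by move: E; rewrite En => /addIn.
Qed.

Section TableSemantics.
Variables (B d gn s0 : nat) (ts : seq trans).
Hypothesis B0 : 0 < B.
Hypothesis s0gn : s0 < gn.
Hypothesis ts_wf : forall tr, tr \in ts ->
  [/\ tr.1 < gn, size tr.2.1 = d & size tr.2.2 = gn].

Let g1 := gn.+1.
Let C := B ^ d.

Fixpoint rwalk (s : nat) (w : seq trans) (s' : nat) : bool :=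
  if w is tr :: w' then [&& tr \in ts, tr.1 == s & rwalk (target_of tr.2.2) w' s']
  else s == s'.

Lemma rwalk_rcons s w tr s' :
  rwalk s (rcons w tr) s' = [&& rwalk s w tr.1, tr \in ts & target_of tr.2.2 == s'].
Proof.
elim: w s => [|x w IH] s /=; first by rewrite eq_sym andbCA.
by rewrite IH !andbA.
Qed.

Definition out_code (w : seq trans) : nat := \sum_(tr <- w) weigh B 1 tr.2.1.

Definition node (w : seq trans) (s : nat) : nat := (out_code w + size w * C) * g1 + s.

Lemma dest_node w tr : tr \in ts ->
  dest B g1 d (node w tr.1 - tr.1) tr = node (rcons w tr) (target_of tr.2.2).
Proof.
move=> Htr; rewrite /dest /node addnK weighM /out_code -cats1 big_cat /= big_seq1 size_cat /=.
rewrite -/C; nia.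
Qed.

Lemma node_mod w s : s < g1 -> node w s %% g1 = s.
Proof. by move=> lts; rewrite /node modnMDl modn_small. Qed.

Lemma target_le tr : tr \in ts -> target_of tr.2.2 <= gn.
Proof. by move=> /ts_wf [_ _ <-]; exact: find_size. Qed.

Lemma fire_mono base s x (T : nat -> bool) l y : T y -> foldl (fire B g1 d base s x) T l y.
Proof.
elim: l T => //= tr l IH T Ty; apply: IH.
by rewrite /fire; case: ifP => // _; rewrite /upd; case: ifP.
Qed.

Lemma fire_complete base s x (T : nat -> bool) l tr :
  tr \in l -> tr.1 == s -> T x -> foldl (fire B g1 d base s x) T l (dest B g1 d base tr).
Proof.
move=> + Es; elim: l T => //= tr' l IH T; rewrite inE => /orP[/eqP <-|Hl] Tx.
  by apply: fire_mono; rewrite /fire Es Tx /= /upd eqxx.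
by apply: IH => //; apply: (@fire_mono base s x T [:: tr'] x).
Qed.

Lemma fire_sound (P : nat -> Prop) base s x (T : nat -> bool) l :
  (forall y, T y -> P y) ->
  (forall tr, tr \in l -> tr.1 == s -> P x -> P (dest B g1 d base tr)) ->
  forall y, foldl (fire B g1 d base s x) T l y -> P y.
Proof.
elim: l T => //= tr l IH T HT Hl; apply: IH; last first.
  by move=> tr' Htr'; apply: Hl; rewrite inE Htr' orbT.
move=> y; rewrite /fire; case: ifP => [/andP[Es Tx]|_]; last exact: HT.
rewrite /upd; case: eqP => [-> _|_]; last exact: HT.
by apply: Hl => //; [rewrite inE eqxx | exact: HT].
Qed.

Lemma tab_sound x y : tab B g1 d s0 ts x y ->
  exists w s, rwalk s0 w s /\ y = node w s.
Proof.
elim: x y => [|x IH] y /=.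
  rewrite /upd; case: eqP => // -> _; exists [::], s0.
  by rewrite /= eqxx /node /out_code big_nil.
apply: (fire_sound IH) => tr Htr /eqP Es [w [s [Hw Ex]]].
have [ltr _ _] := ts_wf Htr.
have les : s <= gn.
  case/lastP: w Hw {Ex} => [/= /eqP <-|w tr']; first exact: ltnW.
  by rewrite rwalk_rcons => /and3P[_ /target_le + /eqP <-].
have Es' : s = tr.1 by rewrite Es Ex node_mod.
exists (rcons w tr), (target_of tr.2.2).
rewrite rwalk_rcons Htr eqxx -Es' Hw; split => //.
by rewrite -Es Ex Es' dest_node.
Qed.

Lemma tab_mono x x' y : x <= x' -> tab B g1 d s0 ts x y -> tab B g1 d s0 ts x' y.
Proof.
move=> /subnK <-; elim: (x' - x) => // n IH Hy.
by rewrite addSn; apply: fire_mono; exact: IH.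
Qed.

Lemma tab_complete w s : rwalk s0 w s -> tab B g1 d s0 ts (node w s) (node w s).
Proof.
elim/last_ind: w s => [|w tr IH] s.
  move=> /= /eqP <-; apply: (@tab_mono 0) => //.
  by rewrite /node /out_code big_nil /= /upd eqxx.
rewrite rwalk_rcons => /and3P[Hw Htr /eqP <-].
have [ltr _ _] := ts_wf Htr.
(* The node before the last transition is smaller: the unit of length is at least [g1], which
   exceeds the state that is subtracted, even if the output is zero and the target is state 0. *)
rewrite -{2}dest_node //; apply: (@tab_mono (node w tr.1).+1).
  rewrite -dest_node // /dest.
  have : g1 <= g1 * B ^ d by rewrite leq_pmulr // expn_gt0 B0.
  have : tr.1 <= node w tr.1 by rewrite /node leq_addl.
  move: ltr (g1 * B ^ d) (node w tr.1) => ltr G M; rewrite /g1; lia.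
have ltr1 : tr.1 < g1 by exact: ltnW.
rewrite /= /advance node_mod //.
by apply: fire_complete; rewrite ?eqxx //; exact: IH.
Qed.

Lemma accP x c : reflect
  (exists y, [/\ y < x, y %% g1 = gn, tab B g1 d s0 ts y.+1 y & (y %/ g1) %% C = c])
  (acc B g1 d s0 ts C x c).
Proof.
apply: (iffP idP).
  elim: x => //= x IH; case: ifP => [/andP[/eqP Ey Ty]|_].
    rewrite /upd; case: eqP => [-> _|_]; first by exists x.
    by move=> /IH[y [? ? ? ?]]; exists y; split => //; exact: ltnW.
  by move=> /IH[y [? ? ? ?]]; exists y; split => //; exact: ltnW.
elim: x => [|x IH] [y [//]]; rewrite ltnS leq_eqVlt => /orP[/eqP ->|lty] E1 E2 E3 /=.
  by move: E2 => /= ->; rewrite E1 eqxx /= /upd E3 eqxx.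
have H : acc B g1 d s0 ts C x c by apply: IH; exists y.
by case: ifP => // _; rewrite /upd; case: ifP.
Qed.

Lemma out_codeE w : {subset w <= ts} -> out_code w = \sum_(j < d) digit w j * B ^ j.
Proof.
move=> Hw; rewrite /out_code (eq_big_seq (fun tr : trans => \sum_(j < d) (0 < nth 0 tr.2.1 j) * B ^ j)).
  by rewrite exchange_big; apply: eq_bigr => j _; rewrite big_distrl.
by move=> tr /Hw /ts_wf [_ <- _]; exact: weighE.
Qed.

Lemma rwalk_sub s w s' : rwalk s w s' -> {subset w <= ts}.
Proof.
elim: w s => //= tr w IH s /and3P[Htr _ /IH Hw] x; rewrite inE.
by case/orP=> [/eqP ->|/Hw].
Qed.

Lemma out_code_lt s w s' : rwalk s w s' -> size w < B -> out_code w < C.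
Proof.
move=> /rwalk_sub Hw lt; rewrite out_codeE //; apply: digits_lt => j.
exact: leq_ltn_trans (digit_le _ _) lt.
Qed.

Lemma acc_walkP c : reflect
  (exists w, [/\ rwalk s0 w gn, size w < B & out_code w = c])
  (acc B g1 d s0 ts C (B * C * g1) c).
Proof.
have C0 : 0 < C by rewrite /C expn_gt0 B0.
apply: (iffP (accP _ _)) => [[y [lty Ey Ty Ec]]|[w [Hw ltw Ec]]].
  have [w [s [Hw E]]] := tab_sound Ty.
  have les : s < g1.
    case/lastP: w Hw {E} => [/= /eqP <-|w tr']; first by rewrite ltnS ltnW.
    by rewrite rwalk_rcons ltnS => /and3P[_ /target_le + /eqP <-].
  have Es : s = gn by rewrite -Ey E node_mod.
  have Eq : y %/ g1 = out_code w + size w * C.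
    by rewrite E /node divnMDl // divn_small // addn0.
  (* The length bound comes first, from the term [size w * C] alone. It then gives [out_code < C],
     so no carry reaches the length and the remainder is the code. *)
  have ltw : size w < B.
    have : y %/ g1 < B * C by rewrite ltn_divLR.
    rewrite Eq => lt; rewrite -(ltn_pmul2r C0); apply: leq_ltn_trans lt.
    exact: leq_addl.
  exists w; rewrite -{1}Es; split => //.
  by rewrite -Ec Eq addnC modnMDl modn_small // (out_code_lt Hw).
have ltc := out_code_lt Hw ltw.
have Eq : node w gn %/ g1 = out_code w + size w * C.
  by rewrite /node divnMDl // divn_small // addn0.
exists (node w gn); split.
- rewrite -ltn_divLR // Eq.
  have : (size w).+1 * C <= B * C by rewrite leq_mul2r ltw orbT.
  by rewrite mulSn; lia.
- by rewrite node_mod.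
- by apply: tab_mono (leqnSn _) _; exact: tab_complete.
- by rewrite Eq addnC modnMDl modn_small.
Qed.

End TableSemantics.

Lemma tables_meet B d gn s0 ts gn' s0' ts' : 0 < B -> s0 < gn -> s0' < gn' ->
  (forall tr, tr \in ts -> [/\ tr.1 < gn, size tr.2.1 = d & size tr.2.2 = gn]) ->
  (forall tr, tr \in ts' -> [/\ tr.1 < gn', size tr.2.1 = d & size tr.2.2 = gn']) ->
  let C := B ^ d in
  reflect (exists w w', [/\ rwalk ts s0 w gn /\ rwalk ts' s0' w' gn', size w < B, size w' < B &
            forall j, j < d -> digit w j = digit w' j])
    (has (fun c => acc B gn.+1 d s0 ts C (B * C * gn.+1) c &&
                   acc B gn'.+1 d s0' ts' C (B * C * gn'.+1) c) (iota 0 C)).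
Proof.
move=> B0 ls ls' Hts Hts' C; apply: (iffP hasP) => [[c _ /andP[]]|].
  move=> /acc_walkP - /(_ B0 ls Hts)[w [Hw lw Ew]].
  move=> /acc_walkP - /(_ B0 ls' Hts')[w' [Hw' lw' Ew']].
  exists w, w'; split => //; apply: (@digits_inj B d) => [j|j|].
  - exact: leq_ltn_trans (digit_le _ _) lw.
  - exact: leq_ltn_trans (digit_le _ _) lw'.
  - rewrite -(out_codeE B Hts (rwalk_sub Hw)) -(out_codeE B Hts' (rwalk_sub Hw')).
    by rewrite Ew Ew'.
case=> w [w' [[Hw Hw'] lw lw' E]]; exists (out_code B w).
  by rewrite mem_iota /= add0n (out_code_lt Hts Hw).
apply/andP; split; apply/acc_walkP => //; [by exists w | exists w'; split => //].
rewrite (out_codeE B Hts (rwalk_sub Hw)) (out_codeE B Hts' (rwalk_sub Hw')).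
by apply: eq_bigr => j _; rewrite E.
Qed.

(** * Walks in multigraphs *)

Section Walks.
Variables (E : eqType) (V : finType) (src tgt : E -> V).

Fixpoint ewalk (s : V) (w : seq E) (e : V) : bool :=
  if w is x :: w' then (src x == s) && ewalk (tgt x) w' e else s == e.

Definition vend (s : V) (w : seq E) : V := last s (map tgt w).
Definition visited (s : V) (w : seq E) : seq V := s :: map tgt w.

Lemma ewalk_cat s w1 w2 e :
  ewalk s (w1 ++ w2) e = ewalk s w1 (vend s w1) && ewalk (vend s w1) w2 e.
Proof. by elim: w1 s => [|x w1 IH] s /=; rewrite /vend /= ?eqxx // IH andbA. Qed.

Lemma ewalk_vend s w e : ewalk s w e -> vend s w = e.
Proof. by elim: w s => [|x w IH] s /=; [move/eqP | case/andP=> _ /IH]. Qed.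

Lemma ewalk_rcons s w x e :
  ewalk s (rcons w x) e = ewalk s w (src x) && (tgt x == e).
Proof.
elim: w s => [|y w IH] s /=; first by rewrite eq_sym.
by rewrite IH andbA.
Qed.

Lemma visited_split s w v : v \in visited s w ->
  exists w1 w2, w = w1 ++ w2 /\ vend s w1 = v.
Proof.
elim: w s => [|x w IH] s; rewrite /visited in_cons => /orP[/eqP ->|].
- by exists [::], [::].
- by [].
- by exists [::], (x :: w).
- by move=> /IH[w1 [w2 [-> <-]]]; exists (x :: w1), w2.
Qed.

Lemma visited_perm s w w' c : perm_eq w' (c ++ w) -> {subset visited s w <= visited s w'}.
Proof.
move=> P v; rewrite !inE => /orP[-> //|H].
by rewrite (perm_mem (perm_map tgt P)) map_cat mem_cat H !orbT.
Qed.

Lemma insert_cycle s w e v c : ewalk s w e -> v \in visited s w -> ewalk v c v ->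
  exists2 w', ewalk s w' e & perm_eq w' (c ++ w).
Proof.
move=> Hw /visited_split[w1 [w2 [Ew Ev]]] Hc; exists (w1 ++ c ++ w2).
  move: Hw; rewrite Ew !ewalk_cat Ev (ewalk_vend Hc) Hc.
  by case/andP=> -> ->.
by rewrite Ew perm_catCA.
Qed.

Lemma insert_cycles s w e cs : ewalk s w e ->
  (forall c, c \in cs -> exists2 v, v \in visited s w & ewalk v c v) ->
  exists2 w', ewalk s w' e & perm_eq w' (flatten cs ++ w).
Proof.
move=> Hw; elim: cs => [|c cs IH] Hcs; first by exists w.
have [|w1 Hw1 P1] := IH; first by move=> c' H; apply: Hcs; rewrite inE H orbT.
have [v Hv Hc] := Hcs c (mem_head _ _).
have [w2 Hw2 P2] := insert_cycle Hw1 (visited_perm P1 Hv) Hc.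
exists w2 => //; apply: (perm_trans P2).
by rewrite /= -catA perm_cat2l.
Qed.

(** * Euler walks and skeletons *)

Definition balanced (l : seq E) (s e : V) : Prop :=
  forall v, count (fun x => src x == v) l + (v == e) = count (fun x => tgt x == v) l + (v == s).

Lemma balanced_perm l l' s e : perm_eq l l' -> balanced l s e -> balanced l' s e.
Proof. by move=> /permP P Hb v; rewrite -!P. Qed.

Lemma balanced_cons x l e : balanced (x :: l) (src x) e -> balanced l (tgt x) e.
Proof.
by move=> Hb v; have := Hb v; rewrite /= [v == src x]eq_sym [v == tgt x]eq_sym; lia.
Qed.

Lemma balanced_walk s w e l : ewalk s w e -> balanced (w ++ l) s e ->
  forall v, balanced l v v.
Proof.
elim: w s => [|x w IH] s /=.
  by move=> /eqP <- Hb v u; have := Hb u; lia.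
move=> /andP[/eqP <- Hw] Hb; apply: IH Hw _.
exact: balanced_cons Hb.
Qed.

Lemma greedy_walk l s e : balanced l s e ->
  exists w r, perm_eq l (w ++ r) /\ ewalk s w e.
Proof.
move: {2}(size l) (erefl (size l)) => n; elim: n l s => [|n IH] l s Es Hb.
  exists [::], l; split => //=; move: (Hb s); rewrite (size0nil Es) /= eqxx.
  by case: eqP.
have [Ese|ne] := eqVneq s e; first by exists [::], l; rewrite /= Ese eqxx.
have : has (fun x => src x == s) l.
  by rewrite has_count; have := Hb s; rewrite eqxx (negbTE ne); lia.
case/hasP=> x Hx /eqP Ex; have P := perm_to_rem Hx.
have Hb' : balanced (rem x l) (tgt x) e.
  by apply: balanced_cons; rewrite Ex; apply: balanced_perm Hb.
have [|w [r [Pw Hw]]] := IH _ _ _ Hb'; first by rewrite size_rem // Es.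
exists (x :: w), r; split; last by rewrite /= Ex eqxx.
by apply: (perm_trans P); rewrite /= perm_cons.
Qed.

Lemma leave_set (S : pred V) s p z : ewalk s p z -> S s -> ~~ S z ->
  exists x, [/\ x \in p, S (src x) & ~~ S (tgt x)].
Proof.
elim: p s => [|x p IH] s /=; first by move=> /eqP <- ->.
move=> /andP[/eqP Ex Hp] Ss Sz; case: (boolP (S (tgt x))) => St.
  by have [y [Hy ? ?]] := IH _ Hp St Sz; exists y; rewrite inE Hy orbT.
by exists x; rewrite mem_head Ex.
Qed.

Lemma euler_walk l s e : balanced l s e ->
  (forall x, x \in l -> exists2 p, all (mem l) p & ewalk s p (src x)) ->
  exists2 w, ewalk s w e & perm_eq w l.
Proof.
move=> Hb Hconn.
have L n w r : size r <= n -> perm_eq (w ++ r) l -> ewalk s w e ->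
    exists2 w, ewalk s w e & perm_eq w l.
  elim: n w r => [|n IH] w r.
    by rewrite leqn0 => /nilP -> P Hw; exists w; rewrite // -[w]cats0.
  move=> ltr P Hw; case: r ltr P => [|x r] ltr P; first by exists w; rewrite // -[w]cats0.
  pose S := mem (visited s w).
  have Hxl y : y \in x :: r -> y \in l by move=> H; rewrite -(perm_mem P) mem_cat H orbT.
  have [g Hg Sg] : exists2 g, g \in x :: r & S (src g).
    case: (boolP (S (src x))) => Sx; first by exists x; rewrite ?mem_head.
    have [p Hp Hpw] := Hconn x (Hxl _ (mem_head _ _)).
    have [g [Hgp Sg Ng]] := leave_set Hpw (mem_head s _ : S s) Sx.
    exists g => //; have := allP Hp g Hgp; rewrite /= -(perm_mem P) mem_cat.
    case/orP=> // Hgw; case/negP: Ng.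
    by rewrite /S /= inE map_f ?orbT.
  have Pg := perm_to_rem Hg.
  (* Taking [g] as first edge makes the closed walk nonempty; [greedy_walk] stops at once when start
     and end agree. *)
  have Hbr : balanced (g :: rem g (x :: r)) (src g) (src g).
    apply: balanced_perm Pg _; apply: balanced_walk Hw _ _.
    by apply: balanced_perm Hb; rewrite perm_sym.
  have [c [r' [Pc Hc]]] := greedy_walk (balanced_cons Hbr).
  have [|w' Hw' Pw'] := insert_cycle (c := g :: c) Hw Sg; first by rewrite /= eqxx.
  apply: (IH w' r') => //.
    have [Eg Ec] := (perm_size Pg, perm_size Pc); rewrite /= size_cat in Eg Ec.
    by move: ltr; rewrite /= !ltnS in Eg *; case: Eg => ->; rewrite Ec; apply: leq_trans; exact: leq_addl.
  apply: perm_trans P; apply: (@perm_trans _ (((g :: c) ++ w) ++ r')).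
    by rewrite perm_cat2r.
  rewrite -catA perm_catCA perm_cat2l perm_sym.
  by apply: perm_trans Pg _; rewrite cat_cons perm_cons.
have [w [r [P Hw]]] := greedy_walk Hb.
by apply: (L (size r) w r) => //; rewrite perm_sym.
Qed.

Let N := #|V|.

Lemma uniq_size (vs : seq V) : uniq vs -> size vs <= N.
Proof. by move=> /card_uniqP <-; exact: max_card. Qed.

(** At most [N] vertices are ever discovered, and each discovery freezes a simple piece of at most
    [N] edges; hence the square. The invariant charges [N] to each visited vertex, the share of the
    start vertex paying for the current simple tail. *)
Lemma skeleton s w e : ewalk s w e ->
  exists w0 cs, [/\ perm_eq w (flatten cs ++ w0), ewalk s w0 e, size w0 <= N * N &
    forall c, c \in cs -> size c <= N /\ exists2 v, v \in visited s w0 & ewalk v c v].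
Proof.
move=> Hw.
(* [k] ends at the vertex discovered last, so that loops can be erased from the
   simple walk [g] issued from there without losing any visited vertex. *)
suff: exists k g cs,
    [/\ perm_eq w (flatten cs ++ k ++ g), ewalk s (k ++ g) e,
        {subset visited s w <= visited s k} /\ uniq (visited (vend s k) g),
        size k + N <= N * #|visited s k| &
        forall c, c \in cs -> size c <= N /\ exists2 v, v \in visited s k & ewalk v c v].
  case=> k [g [cs [P Hkg [Hv U] lek Hcs]]]; exists (k ++ g), cs; split => //.
    have := uniq_size U; rewrite /= size_map size_cat => leg.
    have : N * #|visited s k| <= N * N by rewrite leq_mul2l max_card orbT.
    lia.
  move=> c /Hcs [lec [v Hvk Hc]]; split => //; exists v => //.
  by move: Hvk; rewrite !inE map_cat mem_cat => /orP[->|->] //; rewrite orbT.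
elim/last_ind: w e Hw => [|w x IH] e.
  move=> /= /eqP <-; exists [::], [::], [::]; split => //=; first by split.
  by rewrite (@eq_card1 _ s) ?muln1 // => v; rewrite inE.
rewrite ewalk_rcons => /andP[Hw /eqP <-].
have [k [g [cs [P Hkg [Hv U] lek Hcs]]]] := IH _ Hw.
have Pw : perm_eq (rcons w x) (flatten cs ++ k ++ rcons g x).
  rewrite -!cats1 !catA; rewrite perm_cat2r -catA; exact: P.
have Hkgx : ewalk s (k ++ rcons g x) (tgt x).
  by rewrite -rcons_cat ewalk_rcons Hkg eqxx.
have sg : size g < N by have := uniq_size U; rewrite /= size_map.
have Hv' u : u \in visited s (rcons w x) -> u \in visited s w \/ u = tgt x.
  by rewrite !inE map_rcons mem_rcons inE => /or3P[->|/eqP ->|->]; rewrite ?orbT; auto.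
(* A new vertex freezes the whole tail into [k]; a vertex already on the tail closes a loop, which
   is cut off; any other vertex just prolongs the tail. *)
case: (boolP (tgt x \in visited s k)) => Hx; last first.
  have Hsub u : u \in visited s k -> u \in visited s (k ++ rcons g x).
    by rewrite !inE map_cat mem_cat => /orP[->|->] //; rewrite orbT.
  have Hnew : tgt x \in visited s (k ++ rcons g x).
    by rewrite inE map_cat mem_cat map_rcons mem_rcons mem_head !orbT.
  exists (k ++ rcons g x), [::], cs; split; rewrite ?cats0 //.
  - by split => // u /Hv' [/Hv /Hsub|->].
  - have : #|visited s k| < #|visited s (k ++ rcons g x)|.
      apply: proper_card; apply/properP; split; first by apply/subsetP.
      by exists (tgt x).
    rewrite size_cat size_rcons => ltc.
    have : N * #|visited s k|.+1 <= N * #|visited s (k ++ rcons g x)|.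
      by rewrite leq_mul2l ltc orbT.
    by rewrite mulnS; apply: leq_trans; rewrite addnAC addnC leq_add.
  - move=> c /Hcs [lec [v Hvk Hc]]; split => //; exists v => //; exact: Hsub.
case: (boolP (tgt x \in visited (vend s k) g)) => Hxg.
  have [g1 [g2 [Eg Ev]]] := visited_split Hxg.
  move: Hkg; rewrite Eg !ewalk_cat Ev => /and3P[Hk Hg1 Hg2].
  exists k, g1, ((rcons g2 x) :: cs); split.
  - apply: (perm_trans Pw); rewrite Eg rcons_cat /= -catA.
    by rewrite perm_sym perm_catC -!catA.
  - by rewrite ewalk_cat Hk.
  - split; first by move=> u /Hv' [/Hv //|->].
    by move: U; rewrite Eg /visited map_cat -cat_cons cat_uniq => /andP[].
  - by [].
  - move=> c; rewrite inE => /orP[/eqP ->|]; last exact: Hcs.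
    split; first by rewrite size_rcons; apply: leq_ltn_trans sg; rewrite Eg size_cat leq_addl.
    by exists (tgt x) => //; rewrite ewalk_rcons Hg2 eqxx.
exists k, (rcons g x), cs; split => //.
split; first by move=> u /Hv' [/Hv //|->].
by rewrite /visited map_rcons -rcons_cons rcons_uniq Hxg.
Qed.

End Walks.

(** * Short walks with equal outputs *)

Section ZeroSum.
Import GRing.Theory Num.Theory Order.TTheory.
Local Open Scope ring_scope.

Lemma sum_neg (X : eqType) (f : X -> int) (l : seq X) :
  (forall x, x \in l -> f x < 0) -> l != [::] -> \sum_(x <- l) f x < 0.
Proof.
elim: l => // x l IH Hl _; rewrite big_cons.
have Hx := Hl x (mem_head _ _).
have [->|nl] := eqVneq l [::]; first by rewrite big_nil addr0.
have := IH _ nl; move: (\sum_(_ <- _) _) => S H.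
have {}H : S < 0 by apply: H => y Hy; apply: Hl; rewrite inE Hy orbT.
lia.
Qed.

Lemma sum_pos (X : eqType) (f : X -> int) (l : seq X) :
  (forall x, x \in l -> 0 < f x) -> l != [::] -> 0 < \sum_(x <- l) f x.
Proof.
move=> Hl nl; have := @sum_neg X (fun x => - f x) l _ nl.
rewrite sumrN oppr_lt0; apply => x Hx; rewrite oppr_lt0; exact: Hl.
Qed.

(** An item whose sign is opposite to the current sum keeps it within [M], and one exists because
    otherwise the total could not vanish. *)
Lemma balanced_order (X : eqType) (f : X -> int) (M : nat) (S : int) (l : seq X) :
  (forall x, x \in l -> `|f x| <= M%:Z) -> `|S| <= M%:Z -> S + \sum_(x <- l) f x = 0 ->
  exists2 l', perm_eq l l' & forall i, `|S + \sum_(x <- take i l') f x| <= M%:Z.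
Proof.
move: {2}(size l) (erefl (size l)) => n; elim: n l S => [|n IH] l S Es Hf HS H0.
  by rewrite (size0nil Es); exists [::] => // i; rewrite big_nil addr0.
have nl : l != [::] by case: l Es {Hf H0}.
have [x Hx Hsx] : exists2 x, x \in l & `|S + f x| <= M%:Z.
  case: (lerP S 0) => lS.
    case: (boolP (has (fun x => 0 <= f x) l)) => [/hasP[x Hx fx]|/hasPn H].
      by exists x => //; have := Hf x Hx; lia.
    have : \sum_(x <- l) f x < 0 by apply: sum_neg => // x Hx; rewrite ltNge H.
    by move: H0; move: (\sum_(_ <- _) _) => T; lia.
  case: (boolP (has (fun x => f x <= 0) l)) => [/hasP[x Hx fx]|/hasPn H].
    by exists x => //; have := Hf x Hx; lia.
  have : 0 < \sum_(x <- l) f x by apply: sum_pos => // x Hx; rewrite ltNge H.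
  by move: H0; move: (\sum_(_ <- _) _) => T; lia.
have P := perm_to_rem Hx.
have [||||l' P' Hl'] := IH (rem x l) (S + f x).
- by rewrite size_rem // Es.
- by move=> y /mem_rem; apply: Hf.
- exact: Hsx.
- by move: H0; rewrite (perm_big _ P) big_cons addrA.
exists (x :: l'); first by apply: perm_trans P _; rewrite perm_cons.
case=> [|i]; first by rewrite take0 big_nil addr0.
by rewrite /= big_cons addrA.
Qed.

(** Pigeonhole: among the first [2M+2] partial sums, the empty one included, two agree, since only
    [2M+1] values are available (shifting by [M] makes them naturals). The segment between them is a
    zero-sum block. *)
Lemma zero_sum_blocks (X : eqType) (f : X -> int) (M : nat) (l : seq X) :
  (forall x, x \in l -> `|f x| <= M%:Z) -> \sum_(x <- l) f x = 0 ->
  exists2 bs : seq (seq X), perm_eq l (flatten bs) &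
    forall b, b \in bs -> \sum_(x <- b) f x = 0 /\ (size b <= (2 * M).+1)%N.
Proof.
move: {2}(size l) (leqnn (size l)) => n; elim: n l => [|n IH] l les Hf H0.
  by move: les; rewrite leqn0 => /nilP ->; exists [::].
case: (leqP (size l) (2 * M).+1) => les'.
  by exists [:: l]; rewrite /= ?cats0 // => b; rewrite inE => /eqP ->.
have [||l' P Hl'] := @balanced_order X f M 0 l Hf; rewrite ?add0r //.
have {}Hl' i : `|\sum_(x <- take i l') f x| <= M%:Z by have := Hl' i; rewrite add0r.
pose p i := absz (\sum_(x <- take i l') f x + M%:Z).
have ltp i : (p i < (2 * M).+1)%N.
  by rewrite /p; have := Hl' i; move: (\sum_(_ <- _) _) => T; lia.
have : ~~ uniq (mkseq p (2 * M).+2).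
  apply/negP => U; have := @uniq_leq_size _ _ (iota 0 (2 * M).+1) U.
  rewrite size_mkseq size_iota ltnn => H; have : false by apply: H => i /mapP[j _ ->]; rewrite mem_iota /= add0n ltp.
  by [].
case/(uniqPn 0%N) => i [j [ltij]]; rewrite size_mkseq => ltj.
rewrite !nth_mkseq //; last exact: ltn_trans ltj.
move=> Epij.
have {Epij} Eij : \sum_(x <- take i l') f x = \sum_(x <- take j l') f x.
  move: Epij (Hl' i) (Hl' j); rewrite /p.
  by move: (\sum_(_ <- take i _) _) (\sum_(_ <- take j _) _) => T T'; lia.
pose c := drop i (take j l').
have Etj : take j l' = take i l' ++ c.
  by rewrite -{1}(cat_take_drop i (take j l')) take_takel // ltnW.
have Hc0 : \sum_(x <- c) f x = 0.
  have := Eij; rewrite Etj big_cat /=.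
  by move: (\sum_(_ <- _) _) (\sum_(_ <- c) _) => T T'; lia.
have sl : size l = size l' by apply: perm_size.
have lej : (j <= size l')%N by rewrite -sl; lia.
have sc : size c = (j - i)%N by rewrite size_drop size_takel.
pose r := take i l' ++ drop j l'.
have Pc : perm_eq l (c ++ r).
  apply: (perm_trans P); rewrite -{1}(cat_take_drop j l') Etj /r -catA.
  by rewrite perm_catCA.
have sr : (size r <= n)%N.
  have : size l = (size c + size r)%N by rewrite (perm_size Pc) size_cat.
  by move: les ltij; rewrite sc; lia.
have [||bs Pbs Hbs] := IH r sr.
- by move=> x Hx; apply: Hf; rewrite (perm_mem Pc) mem_cat Hx orbT.
- by move: H0; rewrite (perm_big _ Pc) big_cat /= Hc0 add0r.
exists (c :: bs); first by apply: (perm_trans Pc); rewrite /= perm_cat2l.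
move=> b; rewrite inE => /orP[/eqP ->|]; last exact: Hbs.
by split => //; rewrite sc; lia.
Qed.

Lemma flatten_flatten (X : Type) (bss : seq (seq (seq X))) :
  flatten (flatten bss) = flatten (map flatten bss).
Proof. by elim: bss => //= bs bss IH; rewrite flatten_cat IH. Qed.

Lemma perm_flatten (X : eqType) (l l' : seq (seq X)) :
  perm_eq l l' -> perm_eq (flatten l) (flatten l').
Proof.
move=> P; apply/permP => a; rewrite !count_flatten; apply: perm_sumn.
exact: perm_map.
Qed.

(** A block for one coordinate has at most [2M+1] items, so its sums in the other coordinates are
    bounded by [M * (2M+1)], the bound passed on. *)
Fixpoint block_bound (d M : nat) : nat :=
  if d is d'.+1 then ((2 * M).+1 * block_bound d' (M * (2 * M).+1))%N else 1.

(** One coordinate replaces [m] by its square and contributes a factor [m]: the exponent grows from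
    [E] to [2E + 1], which is at most [3E]. *)
Lemma block_boundE d M m : (2 * M < m)%N -> (block_bound d M <= m ^ (3 ^ d))%N.
Proof.
elim: d M m => [|d IH] M m ltm /=; first by rewrite expn0 expn1; lia.
have H : (block_bound d (M * (2 * M).+1) <= (m ^ 2) ^ (3 ^ d))%N by apply: IH; nia.
apply: (@leq_trans (m * (m ^ 2) ^ (3 ^ d))); first exact: leq_mul.
have pos3 : (0 < 3 ^ d)%N by rewrite expn_gt0.
by rewrite -expnM -expnS leq_pexp2l ?[(3 ^ d.+1)%N]expnS //; lia.
Qed.

(** The blocks obtained for coordinate [d] become the items for the remaining coordinates, which is
    why the item type is generalized in the induction. *)
Lemma zero_sum_vectors d (X : eqType) (f : nat -> X -> int) (M : nat) (l : seq X) :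
  (forall j x, (j < d)%N -> x \in l -> `|f j x| <= M%:Z) ->
  (forall j, (j < d)%N -> \sum_(x <- l) f j x = 0) ->
  exists2 bs : seq (seq X), perm_eq l (flatten bs) &
    forall b, b \in bs -> (forall j, (j < d)%N -> \sum_(x <- b) f j x = 0) /\
                          (size b <= block_bound d M)%N.
Proof.
elim: d X f M l => [|d IH] X f M l Hf H0.
  exists [seq [:: x] | x <- l]; last by move=> b /mapP[x _ ->].
  by rewrite (_ : flatten _ = l) //; elim: l {Hf H0} => //= x l ->.
have [||bs P Hbs] := @zero_sum_blocks X (f d) M l; [by move=> x; apply: Hf|exact: H0|].
have [||bss Pbs Hbss] := IH (seq X) (fun j b => \sum_(x <- b) f j x) (M * (2 * M).+1)%N bs.
- move=> j b ltj Hb; have [_ sb] := Hbs b Hb.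
  apply: (@le_trans _ _ (size b * M)%N%:Z); last by rewrite lez_nat mulnC leq_mul2l sb orbT.
  have Hfb x : x \in b -> `|f j x| <= M%:Z.
    move=> Hx; apply: Hf; first exact: ltnW.
    by rewrite (perm_mem P); apply/flattenP; exists b.
  elim: b Hfb {Hb sb} => [|x b IHb] Hfb; first by rewrite big_nil normr0.
  rewrite big_cons; have := Hfb x (mem_head _ _).
  have := IHb (fun y Hy => Hfb y (mem_behead (s := x :: b) Hy)).
  by move: (\sum_(_ <- _) _) => T /=; rewrite mulSn; lia.
- by move=> j ltj; have := H0 j (ltnW ltj); rewrite (perm_big _ P) big_flatten.
exists (map flatten bss).
  apply: (perm_trans P); rewrite -flatten_flatten; exact: perm_flatten.
move=> b /mapP[bb Hbb ->]; have [H1 H2] := Hbss bb Hbb.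
have Hin c : c \in bb -> c \in bs.
  by move=> Hc; rewrite (perm_mem Pbs); apply/flattenP; exists bb.
split.
  move=> j; rewrite ltnS leq_eqVlt big_flatten => /orP[/eqP ->|/H1 //].
  by rewrite big_seq big1 // => c /Hin /Hbs [].
apply: (@leq_trans (size bb * (2 * M).+1)).
  elim: bb Hin {Hbb H1 H2} => //= c bb IHb Hin; rewrite size_cat mulSn leq_add //.
    by have [] := Hbs c (Hin c (mem_head _ _)).
  by apply: IHb => c' Hc'; apply: Hin; rewrite inE Hc' orbT.
by rewrite /= mulnC leq_mul2l H2 orbT.
Qed.

End ZeroSum.

(** * Shortening two walks with equal outputs *)

Section ShortWalks.
Import GRing.Theory Num.Theory.
Variables (E1 E2 : eqType) (V1 V2 : finType).
Variables (src1 tgt1 : E1 -> V1) (src2 tgt2 : E2 -> V2).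
Variables (o1 : nat -> E1 -> nat) (o2 : nat -> E2 -> nat) (d N : nat).
Hypothesis o1le : forall j x, o1 j x <= 1.
Hypothesis o2le : forall j x, o2 j x <= 1.

Definition out1 j (w : seq E1) := \sum_(x <- w) o1 j x.
Definition out2 j (w : seq E2) := \sum_(x <- w) o2 j x.

Lemma out1_le j w : out1 j w <= size w.
Proof. by rewrite /out1 -sum1_size leq_sum. Qed.

Lemma out2_le j w : out2 j w <= size w.
Proof. by rewrite /out2 -sum1_size leq_sum. Qed.

Lemma out1_cat j w a b : perm_eq w (a ++ b) -> out1 j w = out1 j a + out1 j b.
Proof. by move=> P; rewrite /out1 (perm_big _ P) big_cat. Qed.

Lemma out2_cat j w a b : perm_eq w (a ++ b) -> out2 j w = out2 j a + out2 j b.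
Proof. by move=> P; rewrite /out2 (perm_big _ P) big_cat. Qed.

(** [None] stands for the two skeletons together, [inl] and [inr] for closed walks of the first and
    the second graph. *)
Let item := option (seq E1 + seq E2).

Definition cycles1 (b : seq item) : seq (seq E1) :=
  pmap (fun x : item => if x is Some (inl c) then Some c else None) b.
Definition cycles2 (b : seq item) : seq (seq E2) :=
  pmap (fun x : item => if x is Some (inr c) then Some c else None) b.

Definition effect (k1 : seq E1) (k2 : seq E2) (j : nat) (x : item) : int :=
  match x with
  | None => (out1 j k1)%:Z - (out2 j k2)%:Z
  | Some (inl c) => (out1 j c)%:Z
  | Some (inr c) => - (out2 j c)%:Z
  end%R.

Lemma effect_sum k1 k2 j b : None \notin b ->
  (\sum_(x <- b) effect k1 k2 j x =
   (out1 j (flatten (cycles1 b)))%:Z - (out2 j (flatten (cycles2 b)))%:Z)%R.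
Proof.
elim: b => [|x b IH]; first by rewrite big_nil /out1 /out2 !big_nil subrr.
rewrite inE negb_or => /andP[nx /IH {}IH]; rewrite big_cons IH.
case: x nx => // -[c|c] _ /=.
  by rewrite (out1_cat j (perm_refl _)) PoszD; lia.
by rewrite (out2_cat j (perm_refl _)) PoszD; lia.
Qed.

Lemma mem_cycles1 b c : c \in cycles1 b -> Some (inl c) \in b.
Proof. by rewrite mem_pmap => /mapP[[[c'|c']|] Hx] // [->]. Qed.

Lemma mem_cycles2 b c : c \in cycles2 b -> Some (inr c) \in b.
Proof. by rewrite mem_pmap => /mapP[[[c'|c']|] Hx] // [->]. Qed.

Lemma size_flatten_le (T : eqType) (cs : seq (seq T)) :
  (forall c, c \in cs -> size c <= N) -> size (flatten cs) <= size cs * N.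
Proof.
elim: cs => //= c cs IH H; rewrite size_cat mulSn leq_add //.
  by apply: H; exact: mem_head.
by apply: IH => c' Hc'; apply: H; rewrite inE Hc' orbT.
Qed.

Definition walk_bound : nat := N * N + block_bound d (N * N) * N.

(** Only the block containing [None] is kept. Any selection of closed walks can be reinserted,
    because each is anchored at a vertex of its skeleton, and the block summing to zero says that
    the new outputs agree. *)
Lemma short_walks s1 s2 e1 e2 w1 w2 : #|V1| <= N -> #|V2| <= N ->
  ewalk src1 tgt1 s1 w1 e1 -> ewalk src2 tgt2 s2 w2 e2 ->
  (forall j, j < d -> out1 j w1 = out2 j w2) ->
  exists v1 v2, [/\ ewalk src1 tgt1 s1 v1 e1 /\ ewalk src2 tgt2 s2 v2 e2,
    size v1 <= walk_bound, size v2 <= walk_bound &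
    forall j, j < d -> out1 j v1 = out2 j v2].
Proof.
move=> leV1 leV2 Hw1 Hw2 Eo.
have [k1 [cs1 [P1 Hk1 sk1 Hcs1]]] := skeleton Hw1.
have [k2 [cs2 [P2 Hk2 sk2 Hcs2]]] := skeleton Hw2.
have {}sk1 : size k1 <= N * N by apply: leq_trans sk1 _; exact: leq_mul.
have {}sk2 : size k2 <= N * N by apply: leq_trans sk2 _; exact: leq_mul.
pose l : seq item := None :: [seq Some (inl c) | c <- cs1] ++ [seq Some (inr c) | c <- cs2].
have Nl : None \notin [seq Some (inl c) | c <- cs1] ++ [seq Some (inr c) | c <- cs2].
  by rewrite mem_cat negb_or; apply/andP; split; apply/mapP => -[].
have N1 : 0 < N by apply: leq_trans leV1; apply/card_gt0P; exists s1.
have NN : N <= N * N by rewrite leq_pmulr.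
have c1l : cycles1 l = cs1.
  rewrite /cycles1 /l /= pmap_cat (_ : pmap _ [seq Some (inr c) | c <- cs2] = [::]) ?cats0.
    by elim: (cs1) => //= c cs ->.
  by elim: (cs2).
have c2l : cycles2 l = cs2.
  rewrite /cycles2 /l /= pmap_cat (_ : pmap _ [seq Some (inl c) | c <- cs1] = [::]).
    by elim: (cs2) => //= c cs ->.
  by elim: (cs1).
have scs1 c : c \in cs1 -> size c <= N.
  by move=> /Hcs1[le_c _]; exact: leq_trans leV1.
have scs2 c : c \in cs2 -> size c <= N.
  by move=> /Hcs2[le_c _]; exact: leq_trans leV2.
have [j x ltj Hx|j ltj|bs P Hbs] := @zero_sum_vectors d item (effect k1 k2) (N * N) l.
(* Closed walks have outputs at most [N]. The two skeleton outputs both lie between 0 and [N * N],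
   so their difference is bounded by [N * N] too. *)
- case: x Hx => [[c|c]|] Hx.
  + have Hc : c \in cs1 by rewrite -c1l mem_pmap; apply/mapP; exists (Some (inl c)).
    by rewrite /= ger0_norm // lez_nat (leq_trans (out1_le j c)) // (leq_trans (scs1 c Hc)).
  + have Hc : c \in cs2 by rewrite -c2l mem_pmap; apply/mapP; exists (Some (inr c)).
    by rewrite /= normrN ger0_norm // lez_nat (leq_trans (out2_le j c)) // (leq_trans (scs2 c Hc)).
  + have := leq_trans (out2_le j k2) sk2; have := leq_trans (out1_le j k1) sk1.
    by rewrite /effect; move: (out1 j k1) (out2 j k2) (N * N) => a b M; clear; lia.
- rewrite /l big_cons effect_sum //.
  move: c1l c2l; rewrite /l /cycles1 /cycles2 /= => -> ->.
  have := Eo j ltj; rewrite (out1_cat j P1) (out2_cat j P2) /effect.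
  move: (out1 _ _) (out2 _ _) (out1 _ _) (out2 _ _) => a1 a2 a3 a4; clear; lia.
have [b Hb HN] : exists2 b, b \in bs & None \in b.
  by apply/flattenP; rewrite -(perm_mem P) mem_head.
have [Hb0 sb] := Hbs b Hb.
have Pb := perm_to_rem HN.
pose b' := rem None b.
(* [None] occurs once in the whole family, so the rest of its block consists of closed walks
   only. *)
have Nb' : None \notin b'.
  rewrite -has_pred1 has_count -leqNgt leqn0; apply/eqP.
  have C1 : count_mem None (flatten bs) = 1.
    by rewrite -(permP P) /l /=; rewrite (count_memPn _).
  have : count_mem None b <= 1.
    rewrite -C1 (permP (perm_flatten (perm_to_rem Hb))) /= count_cat.
    exact: leq_addr.
  by rewrite (permP Pb) /= add1n ltnS leqn0 => /eqP.
have sub x : x \in b' -> x \in l.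
  by move=> /mem_rem Hx; rewrite (perm_mem P); apply/flattenP; exists b.
have sb' : size b' <= block_bound d (N * N).
  by apply: leq_trans sb; rewrite size_rem // leq_pred.
have Hc1 c : c \in cycles1 b' -> c \in cs1.
  by move=> /mem_cycles1 /sub Hc; rewrite -c1l mem_pmap; apply/mapP; exists (Some (inl c)).
have Hc2 c : c \in cycles2 b' -> c \in cs2.
  by move=> /mem_cycles2 /sub Hc; rewrite -c2l mem_pmap; apply/mapP; exists (Some (inr c)).
have [|v1 Hv1 Pv1] := insert_cycles (cs := cycles1 b') Hk1.
  by move=> c /Hc1 /Hcs1 [].
have [|v2 Hv2 Pv2] := insert_cycles (cs := cycles2 b') Hk2.
  by move=> c /Hc2 /Hcs2 [].
exists v1, v2; split => //.
- rewrite (perm_size Pv1) size_cat addnC /walk_bound leq_add //.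
  apply: (leq_trans (size_flatten_le _)); first by move=> c /Hc1 /scs1.
  by rewrite leq_mul2r (leq_trans _ sb') ?orbT // size_pmap count_size.
- rewrite (perm_size Pv2) size_cat addnC /walk_bound leq_add //.
  apply: (leq_trans (size_flatten_le _)); first by move=> c /Hc2 /scs2.
  by rewrite leq_mul2r (leq_trans _ sb') ?orbT // size_pmap count_size.
- move=> j ltj; have := Hb0 j ltj; rewrite (perm_big _ Pb) big_cons effect_sum //.
  rewrite -/b' (out1_cat j Pv1) (out2_cat j Pv2) /=.
  move: (out1 _ _) (out2 _ _) (out1 _ _) (out2 _ _) => a1 a2 a3 a4; clear; lia.
Qed.

End ShortWalks.

(** * Walks of regular grammars *)

Lemma big_count_mem (T : finType) (w : seq T) (F : T -> nat) (P : pred T) :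
  \sum_(i | P i) count_mem i w * F i = \sum_(i <- w | P i) F i.
Proof.
elim: w => [|x w IH]; first by rewrite big_nil big1.
rewrite big_cons -IH; under eq_bigr => i _ do rewrite /= mulnDl.
rewrite big_split /= big_mkcond /= (bigD1 x) //= big1 ?addn0 => [|i ne].
  by rewrite eqxx mul1n; case: ifP.
by rewrite eq_sym (negbTE ne) mul0n; case: ifP.
Qed.

Lemma count_sum (T : finType) (w : seq T) (P : pred T) :
  count P w = \sum_(i | P i) count_mem i w.
Proof.
rewrite -sum1_count -big_count_mem.
by apply: eq_bigr => i _; rewrite muln1.
Qed.

Section Regular.
Variables (Sigma : finType) (G : cgrammar Sigma).
Hypothesis regG : regular_grammar G.

Let V := option 'I_(gn G).

Definition gsource (i : gidx G) : V := Some (gsrc i).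
Definition gtarget (i : gidx G) : V := [pick s | 0 < gtgt i s].

(** Regularity makes a target vector either zero or the indicator of one state; a transition becomes
    an edge of a graph whose extra vertex [None] is the empty target. *)
Lemma gtgtE i s : gtgt i s = (gtarget i == Some s).
Proof.
have [_ /(_ i) le1] := regG; rewrite /vsize (bigD1 s) //= in le1.
rewrite /gtarget; case: pickP => [s' Hs'|H]; last first.
  by have := H s; rewrite lt0n => /negbFE/eqP ->.
have [E|ne] := eqVneq s s'.
  rewrite E in le1 *; rewrite eqxx; apply/eqP.
  by rewrite eqn_leq Hs' (leq_trans (leq_addr _ _) le1).
rewrite (bigD1 s') 1?eq_sym //= in le1.
rewrite (_ : (_ == _) = false); last by apply/eqP => -[E]; rewrite E eqxx in ne.
have {le1} : gtgt i s + gtgt i s' <= 1 by apply: leq_trans le1; rewrite leq_add2l leq_addr.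
by move: (gtgt i s) (gtgt i s') Hs' => [|a] [|b]; rewrite // addnS.
Qed.

Lemma gout_le1 (i : gidx G) x : gout i x <= 1.
Proof.
have [[_ _ /(_ i)[le1 _]] _] := regG.
by apply: leq_trans le1; rewrite /vsize (bigD1 x) //= leq_addr.
Qed.

Notation gwalk := (ewalk gsource gtarget).

Lemma walk_of_path i p t : path (fun i j => 0 < gtgt i (gsrc j)) i p ->
  0 < gtgt (last i p) t -> gwalk (gsource i) (i :: p) (Some t).
Proof.
elim: p i => [|j p IH] i /=; first by rewrite gtgtE eqxx lt0b.
by rewrite gtgtE lt0b => /andP[/eqP -> Hp] /(IH _ Hp) /=; rewrite !eqxx.
Qed.

Lemma path_of_walk i p t : gwalk (gsource i) (i :: p) (Some t) ->
  path (fun i j => 0 < gtgt i (gsrc j)) i p /\ 0 < gtgt (last i p) t.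
Proof.
elim: p i => [|j p IH] i /=; first by rewrite gtgtE eqxx lt0b.
case/and3P=> _ /eqP Ej Hp; rewrite gtgtE -Ej eqxx.
by have := IH j; rewrite /= eqxx => /(_ Hp).
Qed.

(** Euler's theorem for the multigraph with [D i] copies of edge [i]; the connectedness of a run
    supplies the required paths. *)
Lemma run_walk D : is_run D ->
  exists2 w, gwalk (Some (gs0 G)) w None & forall i, count_mem i w = D i.
Proof.
move=> [Hbal Hconn].
pose l := flatten [seq nseq (D i) i | i <- enum (gidx G)].
have Hl i : count_mem i l = D i.
  rewrite /l count_flatten -map_comp sumnE big_map big_enum /= (bigD1 i) //= count_nseq /= eqxx mul1n.
  by rewrite big1 ?addn0 // => j /negbTE ne; rewrite count_nseq /= ne mul0n.
have Hcount P : count P l = \sum_(i | P i) D i.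
  by rewrite count_sum; apply: eq_bigr.
have mem_l i : (i \in l) = (0 < D i) by rewrite -has_pred1 has_count Hl.
have Etarget s : \sum_(i | gtarget i == Some s) D i = targetD D s.
  rewrite ffunE big_mkcond; apply: eq_bigr => i _; rewrite gtgtE.
  by case: ifP; rewrite ?muln1 ?muln0.
have Hb : balanced gsource gtarget l (Some (gs0 G)) None.
  case=> [s|]; rewrite !Hcount; first by rewrite Etarget addn0 -Hbal.
  (* Balance at the sink means that exactly one used transition has an empty target. This follows by
     counting all transitions once by source and once by target. *)
  rewrite big_pred0 // addn0 add0n.
  have E1 : \sum_i D i = \sum_s sourceD D s by rewrite (partition_big (@gsrc _ G) predT).
  have E2 : \sum_i D i = \sum_(i | gtarget i == None) D i + \sum_s targetD D s.
    rewrite (partition_big gtarget predT) //= (bigD1 None) //=; congr (_ + _).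
    under [RHS]eq_bigr => s _ do rewrite -Etarget.
    rewrite (@reindex_omap _ _ _ _ _ Some id) //=; last by case.
    by apply: eq_bigl => s; rewrite eqxx.
  have E3 : \sum_s sourceD D s = \sum_s targetD D s + 1.
    rewrite (eq_bigr (fun s => targetD D s + (s == gs0 G))) // big_split /=.
    by congr (_ + _); rewrite (bigD1 (gs0 G)) //= eqxx big1 // => s /negbTE ->.
  by move: E2; rewrite E1 E3 [RHS]addnC => /addnI <-.
have [|w Hw P] := euler_walk Hb; last by exists w => // i; rewrite (permP P).
move=> i; rewrite mem_l => Di.
have : 0 < sourceD D (gsrc i) by rewrite /sourceD (bigD1 i) //= addn_gt0 Di.
case/Hconn=> [Ei|[j [p [Hall Ej Hp Hlast]]]].
  by exists [::]; rewrite /gsource //= Ei.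
exists (j :: p); last by rewrite -Ej; exact: walk_of_path.
by apply: sub_all Hall => k; rewrite /= mem_l.
Qed.

Lemma walk_run w : gwalk (Some (gs0 G)) w None -> is_run [ffun i => count_mem i w].
Proof.
move=> Hw; pose D := [ffun i => count_mem i w].
have Esource s : sourceD D s = count (fun i => gsource i == Some s) w.
  by rewrite count_sum; apply: eq_bigr => i _; rewrite ffunE.
have Etarget s : targetD D s = count (fun i => gtarget i == Some s) w.
  rewrite ffunE count_sum [RHS]big_mkcond; apply: eq_bigr => i _; rewrite ffunE gtgtE.
  by case: ifP; rewrite ?muln1 ?muln0.
split=> [s|t].
  rewrite Esource Etarget.
  have Hbal (u : V) (v : seq (gidx G)) : gwalk u v None ->
      count (fun i => gsource i == Some s) v = count (fun i => gtarget i == Some s) v + (u == Some s).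
    elim: v u => [|i v IH] u /=; first by move=> /eqP ->.
    by move=> /andP[/eqP <- /IH ->]; lia.
  by rewrite (Hbal _ _ Hw) [Some _ == _]eq_sym.
(* The part of the walk before an occurrence of a transition leaving [t] is the path required by
   connectedness; it is empty only if [t] is the initial state. *)
rewrite Esource -has_count => /hasP[i Hi /eqP Ei].
case/splitPr: Hi Hw => w1 w2; rewrite ewalk_cat => /andP[Hw1 /= /andP[/eqP Evi _]].
rewrite -Evi Ei {Evi} in Hw1; case: w1 Hw1 => [/= /eqP[<-]|j p Hw1]; first by left.
have Ej : gsource j = Some (gs0 G) by move: Hw1 => /= /andP[/eqP].
right; exists j, p; rewrite -Ej in Hw1; have [Hp Hlast] := path_of_walk Hw1.
have Hall : all (fun k => 0 < [ffun i0 => count_mem i0 ((j :: p) ++ i :: w2)] k) (j :: p).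
  by apply/allP => k Hk; rewrite ffunE -has_count has_pred1 mem_cat Hk.
by split=> //; case: Ej.
Qed.

Definition walk_out (w : seq (gidx G)) (x : Sigma) : nat := \sum_(i <- w) gout i x.

Lemma gout_setP v : gout_set G v <->
  exists2 w, gwalk (Some (gs0 G)) w None & forall x, walk_out w x = v x.
Proof.
split=> [[D [/run_walk [w Hw Ew] <-]]|[w Hw Ev]].
  exists w => // x; rewrite ffunE /walk_out -[LHS]big_count_mem.
  by apply: eq_bigr => i _; rewrite Ew.
exists [ffun i => count_mem i w]; split; first exact: walk_run.
apply/ffunP => x; rewrite ffunE -Ev /walk_out -[RHS]big_count_mem.
by apply: eq_bigr => i _; rewrite ffunE.
Qed.

Definition raw_trans (tr : 'I_(gn G) * {ffun Sigma -> nat} * {ffun 'I_(gn G) -> nat}) : trans :=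
  (val tr.1.1, ([seq tr.1.2 x | x <- enum Sigma], [seq tr.2 s | s <- enum 'I_(gn G)])).

Definition raw_graph : seq trans := map raw_trans (gdelta G).

Lemma grammar_codeE : grammar_code G = graph_code (gn G) (gs0 G) raw_graph.
Proof.
rewrite /grammar_code /graph_code /raw_graph /all_code size_map -map_comp.
by congr (_ ++ flatten _); apply: eq_map.
Qed.

Lemma raw_graph_wf tr : tr \in raw_graph ->
  [/\ tr.1 < gn G, size tr.2.1 = #|Sigma| & size tr.2.2 = gn G].
Proof.
by move=> /mapP[t _ ->]; split; rewrite //= size_map -cardE ?card_ord.
Qed.

(** The sink gets the number on which the scan for a positive target ends when there is none. *)
Definition state_number (v : V) : nat := if v is Some s then val s else gn G.

Lemma state_number_inj : injective state_number.
Proof.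
case=> [s|] [s'|] //= E; first by congr Some; apply: val_inj.
  by have := ltn_ord s; rewrite E ltnn.
by have := ltn_ord s'; rewrite -E ltnn.
Qed.

Lemma target_number (i : gidx G) : target_of (raw_trans (gtr i)).2.2 = state_number (gtarget i).
Proof.
rewrite /target_of /= find_map.
rewrite (@eq_find _ _ (fun s => gtarget i == Some s)); last first.
  by move=> s; have := gtgtE i s; rewrite /gtgt /= => ->; rewrite lt0b.
case: (gtarget i) => [s|] /=.
  rewrite (@eq_find _ _ (pred1 s)); first exact: index_enum_ord.
  by move=> s'; apply/eqP/eqP => [[->]|->].
by rewrite hasNfind ?size_enum_ord //; apply/hasPn.
Qed.

Lemma raw_walk w v v' : gwalk v w v' ->
  rwalk raw_graph (state_number v) [seq raw_trans (gtr i) | i <- w] (state_number v').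
Proof.
elim: w v => [|i w IH] v /=; first by move=> /eqP ->.
move=> /andP[/eqP <- Hw]; apply/and3P; split; [|exact: eqxx|].
  by apply: map_f; rewrite /gtr; exact: mem_tnth.
by rewrite -[target_of _]/(target_of (raw_trans (gtr i)).2.2) target_number; exact: IH.
Qed.

Lemma walk_of_raw rw v v' : rwalk raw_graph (state_number v) rw (state_number v') ->
  exists2 w, rw = [seq raw_trans (gtr i) | i <- w] & gwalk v w v'.
Proof.
elim: rw v => [|tr rw IH] v /=.
  by move=> /eqP /state_number_inj ->; exists [::] => //=.
case/and3P=> /mapP[t Ht ->] /eqP Ev.
have /tnthP[i Ei] : t \in in_tuple (gdelta G) by [].
have Et : t = gtr i by [].
rewrite Et target_number => /IH[w -> Hw]; exists (i :: w) => //=.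
rewrite Hw andbT; apply/eqP; apply: state_number_inj; rewrite -Ev Et //.
Qed.

(** The program only tests whether an output entry is positive; this loses nothing, since entries
    are at most 1. *)
Lemma digit_out w (x : Sigma) :
  digit [seq raw_trans (gtr i) | i <- w] (enum_rank x) = walk_out w x.
Proof.
rewrite /digit big_map; apply: eq_bigr => i _.
rewrite /= (nth_map x) -?cardE ?ltn_ord // nth_enum_rank.
by have := gout_le1 i x; rewrite /gout; case: (_ x) => [|[]].
Qed.

End Regular.

(** * Polynomial bounds and the decision procedure *)

Definition poly_bounded (f : nat -> nat) : Prop :=
  exists c k, forall n, f n <= c * n.+1 ^ k.

Lemma poly_const a : poly_bounded (fun=> a).
Proof. by exists a, 0 => n; rewrite muln1. Qed.

Lemma poly_id : poly_bounded id.
Proof. by exists 1, 1 => n; rewrite mul1n expn1. Qed.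

Lemma poly_add f g : poly_bounded f -> poly_bounded g -> poly_bounded (fun n => f n + g n).
Proof.
case=> c [k Hf] [c' [k' Hg]]; exists (c + c'), (k + k') => n.
rewrite mulnDl leq_add //.
  by apply: leq_trans (Hf n) _; rewrite leq_mul2l leq_pexp2l ?leq_addr ?orbT.
by apply: leq_trans (Hg n) _; rewrite leq_mul2l leq_pexp2l ?leq_addl ?orbT.
Qed.

Lemma poly_mul f g : poly_bounded f -> poly_bounded g -> poly_bounded (fun n => f n * g n).
Proof.
case=> c [k Hf] [c' [k' Hg]]; exists (c * c'), (k + k') => n.
by rewrite expnD mulnACA leq_mul.
Qed.

Lemma poly_exp f k : poly_bounded f -> poly_bounded (fun n => f n ^ k).
Proof.
move=> Hf; elim: k => [|k IH]; first exact: poly_const.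
have [c [m H]] := poly_mul Hf IH.
by exists c, m => n; rewrite expnS.
Qed.

Lemma poly_le f g : (forall n, f n <= g n) -> poly_bounded g -> poly_bounded f.
Proof. by move=> H [c [k Hg]]; exists c, k => n; exact: leq_trans (Hg n). Qed.

Lemma poly_succ f : poly_bounded f -> poly_bounded (fun n => (f n).+1).
Proof. by move=> Hf; apply: poly_le (poly_add Hf (poly_const 1)) => n; rewrite addn1. Qed.

(** The factor 3 in the exponent comes from [2 * (N * N) < b ^ 3], the factor [3 ^ d] from
    [block_boundE]; the summand 2 absorbs the length [N] of closed walks and the skeleton. *)
Lemma walk_bound_lt d N b : N < b -> walk_bound d N < b ^ (3 * 3 ^ d + 2).
Proof.
move=> ltNb; rewrite /walk_bound.
have ltM : 2 * (N * N) < b ^ 3.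
  by case: b ltNb => // b; rewrite ltnS !expnS expn0 muln1 => leN; nia.
have := block_boundE d ltM; rewrite -expnM; move: (block_bound _ _) => L leL.
have : b <= b ^ (3 * 3 ^ d).
  rewrite -{1}(expn1 b) leq_pexp2l //; first by case: b ltNb {ltM leL}.
  by rewrite muln_gt0 expn_gt0.
rewrite expnD; move: (b ^ (3 * _)) leL => P leL leb.
have : L * N <= P * N by rewrite leq_mul2r leL orbT.
have : P * N <= P * (b - 1) by rewrite leq_mul2l; lia.
have : N * N <= (b - 1) * P by apply: leq_mul; lia.
case: b ltNb leb {ltM} => // b _ leb; rewrite subn1 /= expnS expn1; nia.
Qed.

Lemma digit_out_nth (Sigma : finType) (G : cgrammar Sigma) (w : seq (gidx G)) j :
  digit [seq raw_trans (gtr i) | i <- w] j =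
  out1 (fun j i => (0 < nth 0 (raw_trans (gtr i)).2.1 j) : nat) j w.
Proof. by rewrite /digit /out1 big_map. Qed.

Theorem theorem3 (Sigma : finType) :
  exists (M : TM) (c k : nat),
    forall G H : cgrammar Sigma,
      regular_grammar G -> regular_grammar H ->
      exists b : bool,
        decides_within M (enc_pair G H) (c * (size (enc_pair G H)).+1 ^ k) b /\
        (b = true <-> ~ (exists v, gout_set G v /\ gout_set H v)).
Proof.
pose d := #|Sigma|; pose e := 3 * 3 ^ d + 2.
pose prog := program d e.
(* The bound [d.+3 * N] demanded by each table, with the number of states replaced by the input
   length, which exceeds it. *)
pose K n := d.+3 * (n.+2 ^ e * (n.+2 ^ e) ^ d * n.+2).
pose kk := (nr_program + nm_program).+1.
(* The cost of loading and running, as a function of the input length alone. *)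
pose cost n := n.+1 * ((16 * kk + 100) * n.+1) +
  nops (K n) prog * ((20 * kk + 100) * (n + nops (K n) prog).+1) + kk + 10.
have polyK : poly_bounded K.
  have P2 : poly_bounded (fun n => n.+2) by do 2!apply: poly_succ; exact: poly_id.
  apply: poly_mul; first exact: poly_const.
  by apply: poly_mul => //; apply: poly_mul; do ?apply: poly_exp.
have polyN : poly_bounded (fun n => nops (K n) prog).
  apply: poly_le (poly_mul (poly_const (cmd_size prog)) (poly_exp (cmd_size prog) (poly_succ polyK))) => n.
  exact: nops_poly.
have [c [k Hcost]] : poly_bounded cost.
  do 2!(apply: poly_add; last exact: poly_const).
  apply: poly_add; last first.
    apply: poly_mul => //; apply: poly_mul; first exact: poly_const.
    by apply: poly_succ; apply: poly_add => //; exact: poly_id.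
  apply: poly_mul; first by apply: poly_succ; exact: poly_id.
  by apply: poly_mul; [exact: poly_const | apply: poly_succ; exact: poly_id].
exists (machine (full_code nr_program nm_program prog rBAD)), c, k => G H regG regH.
set n := size _.
have En : enc_pair G H = enc_nats (graph_code (gn G) (gs0 G) (raw_graph G) ++
                                   graph_code (gn H) (gs0 H) (raw_graph H)).
  by rewrite /enc_pair !grammar_codeE.
have Epos : n = pos (graph_code (gn G) (gs0 G) (raw_graph G) ++
                     graph_code (gn H) (gs0 H) (raw_graph H)) by rewrite /n En.
have ltG : gn G < n.
  by rewrite Epos; apply: pos_ge; rewrite mem_cat mem_head.
have ltH : gn H < n.
  by rewrite Epos; apply: pos_ge; rewrite mem_cat mem_head orbT.
pose B := n.+2 ^ e.
have B0 : 0 < B by rewrite expn_gt0.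
have leK g : g < n -> d.+3 * (B * B ^ d * g.+1) <= K n.
  by move=> ltg; rewrite leq_mul2l leq_mul2l; apply/orP; right; lia.
pose meets := has (fun c => acc B (gn G).+1 d (gs0 G) (raw_graph G) (B ^ d) (B * B ^ d * (gn G).+1) c &&
                  acc B (gn H).+1 d (gs0 H) (raw_graph H) (B ^ d) (B * B ^ d * (gn H).+1) c)
                  (iota 0 (B ^ d)).
have [s' Rs' Es'] : exists2 s', run (K n) prog (loaded (enc_pair G H)) s' &
    (reg s' rBAD == 0) = ~~ meets.
  rewrite En /meets /B Epos; apply: run_program; rewrite -?Epos.
  - by move=> tr /raw_graph_wf[_ -> ->].
  - by move=> tr /raw_graph_wf[_ -> ->].
  - apply: (@leq_trans (B * B ^ d * n.+2)); last exact: leq_pmull.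
    by rewrite leq_pmull // muln_gt0 expn_gt0 B0.
  - exact: leK.
  - exact: leK.
exists (~~ meets); split.
  rewrite -Es'; apply: (@program_decides nr_program nm_program isT isT _ (K n)) => //; first exact: wf_program.
  exact: Hcost.
have Hmeets : reflect _ meets := tables_meet B0 (ltn_ord (gs0 G)) (ltn_ord (gs0 H))
  (@raw_graph_wf _ G) (@raw_graph_wf _ H).
have meetsP : meets <-> exists v, gout_set G v /\ gout_set H v.
  split=> [/Hmeets[rw [rw' [[Hrw Hrw'] _ _ Hd]]]|[v [/(gout_setP regG)[w Hw Ew] /(gout_setP regH)[w' Hw' Ew']]]].
    have [w Erw Hw] := walk_of_raw (v := Some (gs0 G)) (v' := None) regG Hrw.
    have [w' Erw' Hw'] := walk_of_raw (v := Some (gs0 H)) (v' := None) regH Hrw'.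
    exists [ffun x => walk_out w x]; split.
      by apply/(gout_setP regG); exists w => // x; rewrite ffunE.
    apply/(gout_setP regH); exists w' => // x.
    by rewrite ffunE -(digit_out regG) -(digit_out regH) -Erw -Erw' Hd // ltn_ord.
  pose o (F : cgrammar Sigma) j (i : gidx F) : nat := 0 < nth 0 (raw_trans (gtr i)).2.1 j.
  have ole F j i : @o F j i <= 1 by rewrite /o; case: (0 < _).
  (* The sink adds one vertex, which the strict inequality between states and input length
     accommodates. *)
  have cardV m : m < n -> #|{: option 'I_m}| <= n by rewrite card_option card_ord.
  have [j ltj|u [u' [[Hu Hu'] su su' Hd]]] :=
      short_walks (d := d) (ole G) (ole H) (cardV _ ltG) (cardV _ ltH) Hw Hw'.
    have Eo F (u : seq (gidx F)) : regular_grammar F ->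
        out1 (@o F) j u = walk_out u (enum_val (Ordinal ltj)).
      by move=> regF; rewrite -digit_out_nth -(digit_out regF) enum_valK.
    by rewrite (Eo G) // [RHS](Eo H) // Ew Ew'.
  have ltB : walk_bound d n < B by apply: walk_bound_lt.
  apply/Hmeets; exists [seq raw_trans (gtr i) | i <- u], [seq raw_trans (gtr i) | i <- u'].
  split; rewrite ?size_map.
  - by split; [exact: (raw_walk regG Hu) | exact: (raw_walk regH Hu')].
  - exact: leq_ltn_trans ltB.
  - exact: leq_ltn_trans ltB.
  - by move=> j ltj; rewrite !digit_out_nth; exact: Hd.
split=> [/negP nm /meetsP //|nm].
by apply/negP => /meetsP.
Qed.
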